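(* For $p\ge1$, $k=1,\dots,2^{p-1}$: $$\xi_{p,k}=\lim_{N\to\infty}\sqrt{2N}\left(\sum_{l=1}^{p}\frac{1}{\alpha_{l,r(k,l)}}+\sum_{l=1}^{N-p}\frac{1}{\lambda_l(\alpha_{p,k})}-\lambda_N\right),$$ $$\rho_{p,k}=\prod_{l=1}^{p}\Big(1+\frac{1}{\alpha_{l,r(k,l)}^2}\Big)^{-1}\lim_{N\to\infty}\sqrt{2N}\prod_{l=1}^{N}\Big(1+\frac{1}{\lambda_l(\alpha_{p,k})^2}\Big)^{-1},$$ and $$\rho_0=\lim_{N\to\infty}\sqrt{2N}\prod_{l=1}^{N}\Big(1+\frac{1}{\lambda_l^2}\Big)^{-1}.$$
   Context: Let $(m_n)$ be the positive sequence with $m_0=1$, $(1+m_1+\cdots+m_n)m_n=1$ ($n\ge1$), $\mu$ the probability measure on $[0,1]$ with moments $m_n$, and $f$ the meromorphic extension to $\mathbb C$ of $f(z)=\int_0^1\frac{1-t^z}{1-t}\,d\mu(t)$ ($\Re z>0$). Its zeros are $\xi_0=0$ and, for each $p\ge1$, exactly $2^{p-1}$ simple zeros $\xi_{p,1}<\cdots<\xi_{p,2^{p-1}}$ in $]-p-1,-p[$; set $\rho_0=1/f'(0)$, $\rho_{p,k}=1/f'(\xi_{p,k})$. Let $\lambda_0=0$, $\lambda_{n+1}=1/m_n$. $\psi(z)=z-1/z$; $Y_n=\{z:\psi^{\circ n}(z)=0\}$ consists of $2^n$ reals $\alpha_{n,1}<\cdots<\alpha_{n,2^n}$. $r(k,l)$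 is the unique $x\in\{1,\dots,2^l\}$ with $x\equiv k\pmod{2^l}$. For real $s$, $\lambda_0(s)=s$ and $\lambda_{n+1}(s)=\tfrac12\big(\lambda_n(s)+\sqrt{\lambda_n(s)^2+4}\big)$. *)

(* Defs.v *)
From HB Require Import structures.
From mathcomp Require Import all_boot all_order all_algebra.
From mathcomp Require Import all_classical all_reals all_analysis.
From mathcomp Require Import complex.
Set Implicit Arguments. Unset Strict Implicit. Unset Printing Implicit Defensive.
Import Order.TTheory GRing.Theory Num.Theory.
Import numFieldNormedType.Exports.
Local Open Scope classical_set_scope.
Local Open Scope ring_scope.

Section Defs.
Variable R : realType.

Definition psi (z : R) : R := z - z^-1.

(* Y_n = zeros of the rational function psi^{o n}: all intermediate iterates
   must be nonzero (otherwise psi is undefined / has a pole there). *)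
Definition Yset (n : nat) : set R :=
  [set z | (forall j, (j < n)%N -> iter j psi z != 0) /\ iter n psi z = 0].

Definition kth (A : set R) (k : nat) (x : R) : Prop :=
  A x /\ exists s : seq R, [/\ uniq s, size s = k.-1 &
                            forall y, y \in s <-> (A y /\ y < x)].

Definition alpha (n k : nat) : R := xget 0 (kth (Yset n) k).

Fixpoint lams (s : R) (n : nat) : R :=
  if n is n'.+1 then (lams s n' + Num.sqrt (lams s n' ^+ 2 + 4)) / 2 else s.

Definition lam (m : nat -> R) (n : nat) : R :=
  if n is n'.+1 then (m n')^-1 else 0.

End Defs.

(* r(k,l): the unique x in {1..2^l} with x = k mod 2^l (k >= 1) *)
Definition rr (k l : nat) : nat := ((k.-1) %% 2 ^ l).+1.

(* Main.v *)
Require Import Defs.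
From HB Require Import structures.
From mathcomp Require Import all_boot all_order all_algebra.
From mathcomp Require Import all_classical all_reals all_analysis.
From mathcomp Require Import measurable_realfun complex.
From mathcomp Require Import ring lra.
Set Implicit Arguments. Unset Strict Implicit. Unset Printing Implicit Defensive.
Import Order.TTheory GRing.Theory Num.Theory.
Import numFieldNormedType.Exports.
Local Open Scope classical_set_scope.
Local Open Scope ring_scope.

(** With [F x = int (1 - t^x) / (1 - t) dmu] and [G x = int t^x dmu], the
    recurrence for [m] gives [m_k - m_(k+1) = m_(k+1)^2 m_k]; approximating [u^y]
    by polynomials turns it into [G y - G (y+1) = G (y+1)^2 G y], whence
    [F (x+1) G x = 1], that is [F x = psi (F (x+1))].  By the identity theorem
    this functional equation holds for [f] on the real line away from the poles,
    so that a point [x] of the line is regular iff [x + 1] is regular and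
    [f (x+1) <> 0].  Since [f] maps ]-1, 0[ increasingly onto the negative reals,
    the zeros of [f] in ]-p-1, -p[ are the [y - p] with [y] in ]-1, 0[ and
    [f y = alpha_{p,k}]; then [f (y - p + l) = alpha_{l,r(k,l)}] for [l <= p] and
    [f (y + l) = lambda_l (alpha_{p,k})].  Telescoping
    [f (x+1) = f x + 1 / f (x+1)] and [f' x = (1 + f (x+1)^-2) f' (x+1)] leaves
    [f (xi + N) - f N] and [f' (xi + N)], which are controlled by the monotonicity
    of [F'] and by [|F N - sqrt (2 N)| <= 1].

    The identity theorem rests on Goursat's lemma for squares: a holomorphic
    function that vanishes on the boundary of a square vanishes at its center. *)

(** * Goursat's lemma for squares *)

(** The values of [f] are prescribed on the positive half-line, whereas the zeros sought lie on the
    negative one, among poles: an identity has to travel past poles of the very line it lives on. It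
    travels at a small height, since a locally finite set of poles leaves a strip free above every
    compact interval; the identity theorem therefore starts from vanishing on a segment and moves by
    discs of fixed radius. No power series enters: uniqueness from zero boundary values comes from
    Goursat's lemma, and multiplying rotated copies of a function makes one side of a square do the
    work of the whole boundary. The factor [sqrt (2 N)] is [1 / F'] near [N] up to a bounded error:
    the increment of [F] over a unit step is [1 / F (x + 1)], which squeezes [1 / F' x] between
    [F x] and [F (x + 1)]; a bounded error disappears in the ratio with [sqrt (2 N)]. The
    nonvanishing conditions in [Yset] are the regularity of [f] along an orbit of [x -> x - 1],
    which is why zeros and iterated preimages match without exception. *)

Section SegmentIntegral.
Variable R : realType.
Implicit Types (g h : R -> R) (a b c : R).

Definition seg_int g a b := \int[@lebesgue_measure R]_(t in `[a, b]) g t.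

Definition continuous_on g a b := forall t, a <= t <= b -> {for t, continuous g}.

Lemma seg_integrable g a b : continuous_on g a b ->
  (@lebesgue_measure R).-integrable `[a, b] (EFin \o g).
Proof.
move=> gc; apply: continuous_compact_integrable; first exact: segment_compact.
apply: continuous_in_subspaceT => x; rewrite inE/= in_itv/= => xab.
exact: gc.
Qed.

Lemma seg_intB g h a b : continuous_on g a b -> continuous_on h a b ->
  seg_int (fun t => g t - h t) a b = seg_int g a b - seg_int h a b.
Proof. by move=> gc hc; apply: RintegralB => //; exact: seg_integrable. Qed.

Lemma seg_intZ c g a b : continuous_on g a b ->
  seg_int (fun t => c * g t) a b = c * seg_int g a b.
Proof. by move=> gc; apply: RintegralZl => //; exact: seg_integrable. Qed.

Lemma eq_seg_int g h a b : (forall t, a <= t <= b -> g t = h t) ->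
  seg_int g a b = seg_int h a b.
Proof.
move=> gh; apply: eq_Rintegral => t; rewrite inE/= in_itv/=; exact: gh.
Qed.

Lemma seg_int_cat g a b c : a <= b -> b <= c -> continuous_on g a c ->
  seg_int g a c = seg_int g a b + seg_int g b c.
Proof.
move=> ab bc gc; have gi := seg_integrable gc.
have := @Rintegral_itvB R g (BLeft a) (BRight c) b gi.
rewrite !bnd_simp => /(_ ab bc) /eqP; rewrite subr_eq addrC => /eqP.
rewrite /seg_int => ->; congr (_ + _); rewrite Rintegral_itv_obnd_cbnd//.
by apply: integrableS gi => //; apply: subset_itvr; rewrite bnd_simp.
Qed.

Lemma seg_int_cst a b c : a <= b -> seg_int (fun=> c) a b = c * (b - a).
Proof.
move=> ab; rewrite /seg_int Rintegral_cst//= lebesgue_measure_itv/= lte_fin.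
case: ltgtP ab => //= -> _; by rewrite subrr.
Qed.

(** Comparison with constants is the only estimate of integrals used: in [contour] the linear parts
    of opposite sides differ by a constant. *)
Lemma seg_int_near g a b c M : a <= b -> continuous_on g a b ->
  (forall t, a <= t <= b -> `|g t - c| <= M) ->
  `|seg_int g a b - c * (b - a)| <= M * (b - a).
Proof.
move=> ab gc gM.
have cst k : continuous_on (fun=> k) a b by move=> t _; exact: cvg_cst.
have lo : seg_int (fun=> c - M) a b <= seg_int g a b.
  apply: le_Rintegral => //; try exact: seg_integrable.
  by move=> t; rewrite /= in_itv/= => /gM; rewrite ler_norml; lra.
have hi : seg_int g a b <= seg_int (fun=> c + M) a b.
  apply: le_Rintegral => //; try exact: seg_integrable.
  by move=> t; rewrite /= in_itv/= => /gM; rewrite ler_norml; lra.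
move: lo hi; rewrite !seg_int_cst// ler_norml => lo hi; apply/andP; split; lra.
Qed.

End SegmentIntegral.

Section Goursat.
Variable R : realType.
Implicit Types (u v : R -> R -> R) (x y s : R).

Definition continuous2 u x y := forall e : R, 0 < e -> exists2 d : R, 0 < d &
  forall a b : R, `|a| < d -> `|b| < d -> `|u (x + a) (y + b) - u x y| <= e.

(** Differentiability of [u + i v] as a map of the plane, its differential being multiplication by
    [p + i q]. *)
Definition cauchy_riemann u v x y := exists p q : R, forall e : R, 0 < e ->
  exists2 d : R, 0 < d & forall a b : R, `|a| < d -> `|b| < d ->
    `|u (x + a) (y + b) - u x y - (p * a - q * b)| <= e * (`|a| + `|b|) /\
    `|v (x + a) (y + b) - v x y - (q * a + p * b)| <= e * (`|a| + `|b|).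

Definition in_square x y s x' y' := x <= x' <= x + s /\ y <= y' <= y + s.

Definition continuous_square u x y s :=
  forall x' y', in_square x y s x' y' -> continuous2 u x' y'.

(* The real part of the contour integral of [u + i v] around the square
   [x, x + s] * [y, y + s], opposite sides being grouped together. *)
Definition contour u v x y s :=
  seg_int (fun t => u t y - u t (y + s)) x (x + s)
  - seg_int (fun t => v (x + s) t - v x t) y (y + s).

Lemma continuous2_row u a b y : (forall t, a <= t <= b -> continuous2 u t y) ->
  continuous_on (u^~ y) a b.
Proof.
move=> uc t /uc ut; apply/cvgrPdist_le => e e0; have [d d0 ud] := ut e e0.
apply/nbhs_ballP; exists d => // t'; rewrite /ball/= distrC => ht; rewrite distrC.
by have := ud (t' - t) 0; rewrite addr0 normr0 [t + _]addrC subrK; apply.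
Qed.

Lemma continuous2_col u a b x : (forall t, a <= t <= b -> continuous2 u x t) ->
  continuous_on (u x) a b.
Proof.
move=> uc t /uc ut; apply/cvgrPdist_le => e e0; have [d d0 ud] := ut e e0.
apply/nbhs_ballP; exists d => // t'; rewrite /ball/= distrC => ht; rewrite distrC.
by have := ud 0 (t' - t); rewrite addr0 normr0 [t + _]addrC subrK; apply.
Qed.

Lemma continuous_onB (g h : R -> R) a b : continuous_on g a b -> continuous_on h a b ->
  continuous_on (fun t => g t - h t) a b.
Proof. by move=> gc hc t tab; apply: cvgB; [exact: gc|exact: hc]. Qed.

Lemma continuous_onW (g : R -> R) a b a' b' : a <= a' -> b' <= b ->
  continuous_on g a b -> continuous_on g a' b'.
Proof. by move=> aa bb gc t /andP[ta tb]; apply: gc; apply/andP; split; lra. Qed.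

Lemma cauchy_riemann_continuous u v x y :
  cauchy_riemann u v x y -> continuous2 u x y /\ continuous2 v x y.
Proof.
move=> [p [q H]]; have [d d0 Hd] := H 1 ltr01.
(* [|p| + |q|] bounds the differential and [1] the remainder, taken with [e = 1]. *)
pose K := `|p| + `|q| + 1.
have K0 : 0 < K by rewrite /K; have := normr_ge0 p; have := normr_ge0 q; lra.
have bnd (e a b : R) : 0 < e -> `|a| < Num.min d (e / (2 * K)) -> `|b| < Num.min d (e / (2 * K)) ->
    K * (`|a| + `|b|) <= e.
  move=> e0; rewrite !lt_min => /andP[_ ha] /andP[_ hb].
  have -> : e = K * (e / (2 * K) + e / (2 * K)) by field; rewrite gt_eqF.
  by rewrite ler_pM2l//; lra.
split => e e0; exists (Num.min d (e / (2 * K))).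
- by rewrite lt_min d0 divr_gt0// mulr_gt0.
- move=> a b ha hb; apply: le_trans (bnd _ _ _ e0 ha hb).
  move: ha hb; rewrite !lt_min => /andP[ha _] /andP[hb _].
  have [h _] := Hd a b ha hb.
  have -> : u (x + a) (y + b) - u x y
    = (u (x + a) (y + b) - u x y - (p * a - q * b)) + (p * a - q * b) by ring.
  apply: le_trans (ler_normD _ _) _.
  have := ler_normB (p * a) (q * b); rewrite !normrM /K.
  have := normr_ge0 a; have := normr_ge0 b; have := normr_ge0 p; have := normr_ge0 q.
  by nra.
- by rewrite lt_min d0 divr_gt0// mulr_gt0.
- move=> a b ha hb; apply: le_trans (bnd _ _ _ e0 ha hb).
  move: ha hb; rewrite !lt_min => /andP[ha _] /andP[hb _].
  have [_ h] := Hd a b ha hb.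
  have -> : v (x + a) (y + b) - v x y
    = (v (x + a) (y + b) - v x y - (q * a + p * b)) + (q * a + p * b) by ring.
  apply: le_trans (ler_normD _ _) _.
  have := ler_normD (q * a) (p * b); rewrite !normrM /K.
  have := normr_ge0 a; have := normr_ge0 b; have := normr_ge0 p; have := normr_ge0 q.
  by nra.
Qed.

Lemma contour_subdivide u v x y s : 0 <= s ->
  continuous_square u x y (s + s) -> continuous_square v x y (s + s) ->
  contour u v x y (s + s) =
  contour u v x y s + contour u v (x + s) y s +
  contour u v x (y + s) s + contour u v (x + s) (y + s) s.
Proof.
move=> s0 uc vc.
have row w y' : continuous_square w x y (s + s) -> y <= y' <= y + (s + s) ->
    continuous_on (w^~ y') x (x + (s + s)).
  by move=> wc hy; apply: continuous2_row => t ht; exact: wc.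
have col w x' : continuous_square w x y (s + s) -> x <= x' <= x + (s + s) ->
    continuous_on (w x') y (y + (s + s)).
  by move=> wc hx; apply: continuous2_col => t ht; exact: wc.
have y1 : y <= y <= y + (s + s) by lra.
have y2 : y <= y + s <= y + (s + s) by lra.
have y3 : y <= y + (s + s) <= y + (s + s) by lra.
have x1 : x <= x <= x + (s + s) by lra.
have x2 : x <= x + s <= x + (s + s) by lra.
have x3 : x <= x + (s + s) <= x + (s + s) by lra.
rewrite /contour !addrA -!addrA.
have R1 := row _ _ uc y1; have R2 := row _ _ uc y2; have R3 := row _ _ uc y3.
have C1 := col _ _ vc x1; have C2 := col _ _ vc x2; have C3 := col _ _ vc x3.
have L (g : R -> R) c : continuous_on g c (c + (s + s)) -> continuous_on g c (c + s).
  by apply: continuous_onW; lra.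
have H (g : R -> R) c : continuous_on g c (c + (s + s)) -> continuous_on g (c + s) (c + (s + s)).
  by apply: continuous_onW; lra.
rewrite !seg_intB; [|by [|apply: L|apply: H]..].
rewrite !(@seg_int_cat R _ x (x + s) (x + (s + s))); [|by [|lra]..].
rewrite !(@seg_int_cat R _ y (y + s) (y + (s + s))); [|by [|lra]..].
lra.
Qed.

(** The linear part contributes the same constant [q * s] to the integrand in [u] and to the
    integrand in [v], so it cancels. Each integrand keeps two remainders of size [2 * e * s], and
    each of the two integrals has length [s]. *)
Lemma contour_local u v x0 y0 : cauchy_riemann u v x0 y0 ->
  forall e : R, 0 < e -> exists2 d : R, 0 < d & forall x y s : R, 0 <= s < d ->
    in_square x y s x0 y0 -> continuous_square u x y s -> continuous_square v x y s ->
    `|contour u v x y s| <= 8 * e * s ^+ 2.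
Proof.
move=> [p [q H]] e e0; have [d d0 Hd] := H e e0; exists d => // x y s /andP[s0 sd].
move=> [x0s y0s] uc vc; rewrite /contour.
have bnd (a b : R) : `|a| <= s -> `|b| <= s -> e * (`|a| + `|b|) <= 2 * e * s.
  move=> ha hb; rewrite [leRHS](_ : _ = e * (s + s)); last by ring.
  by rewrite ler_pM2l//; lra.
have near a b : x <= a <= x + s -> y <= b <= y + s ->
    `|u a b - u x0 y0 - (p * (a - x0) - q * (b - y0))| <= 2 * e * s /\
    `|v a b - v x0 y0 - (q * (a - x0) + p * (b - y0))| <= 2 * e * s.
  move=> ha hb.
  have la : `|a - x0| <= s by rewrite ler_norml; lra.
  have lb : `|b - y0| <= s by rewrite ler_norml; lra.
  have [] := Hd (a - x0) (b - y0) (le_lt_trans la sd) (le_lt_trans lb sd).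
  rewrite ![x0 + _]addrC ![y0 + _]addrC !subrK => h1 h2.
  by split; [apply: le_trans h1 _|apply: le_trans h2 _]; exact: bnd.
have yy : y <= y <= y + s by lra.
have ys : y <= y + s <= y + s by lra.
have xx : x <= x <= x + s by lra.
have xs : x <= x + s <= x + s by lra.
have -> : 8 * e * s ^+ 2 = 4 * e * s * (x + s - x) + 4 * e * s * (y + s - y) by ring.
set A := seg_int _ _ _; set B := seg_int _ _ _.
have hA : `|A - q * s * (x + s - x)| <= 4 * e * s * (x + s - x).
  apply: seg_int_near; first lra.
    apply: (@continuous_onB (u^~ y) (u^~ (y + s))); apply: continuous2_row => t ht;
    exact: uc.
  move=> t ht; have [h1 _] := near t y ht yy; have [h2 _] := near t (y + s) ht ys.
  move: h1 h2; rewrite !ler_norml => /andP[? ?] /andP[? ?]; apply/andP; split; lra.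
have hB : `|B - q * s * (y + s - y)| <= 4 * e * s * (y + s - y).
  apply: seg_int_near; first lra.
    apply: (@continuous_onB (v (x + s)) (v x)); apply: continuous2_col => t ht;
    exact: vc.
  move=> t ht; have [_ h1] := near x t xx ht; have [_ h2] := near (x + s) t xs ht.
  move: h1 h2; rewrite !ler_norml => /andP[? ?] /andP[? ?]; apply/andP; split; lra.
clearbody A B; move: hA hB; rewrite !ler_norml => /andP[? ?] /andP[? ?].
by apply/andP; split; lra.
Qed.

Lemma contour_quarter u v x y s : 0 <= s ->
  continuous_square u x y s -> continuous_square v x y s ->
  exists x' y', [/\ x <= x' <= x + s / 2, y <= y' <= y + s / 2 &
    `|contour u v x y s| / 4 <= `|contour u v x' y' (s / 2)|].
Proof.
move=> s0 uc vc; have ss : s = s / 2 + s / 2 by field.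
have lo z : z <= z <= z + s / 2 by apply/andP; split; lra.
have hi z : z <= z + s / 2 <= z + s / 2 by apply/andP; split; lra.
have := @contour_subdivide u v x y (s / 2); rewrite -ss => -> //; last by lra.
set a := contour _ _ x y _; set b := contour _ _ (x + _) y _.
set c := contour _ _ x (y + _) _; set d := contour _ _ (x + _) (y + _) _.
have tri : `|a + b + c + d| <= `|a| + `|b| + `|c| + `|d|.
  by do 3![apply: le_trans (ler_normD _ _) _; rewrite lerD2r].
have [ha|ha] := leP (`|a + b + c + d| / 4) `|a|.
  by exists x, y.
have [hb|hb] := leP (`|a + b + c + d| / 4) `|b|.
  by exists (x + s / 2), y.
have [hc|hc] := leP (`|a + b + c + d| / 4) `|c|.
  by exists x, (y + s / 2).
exists (x + s / 2), (y + s / 2); split=> //; rewrite -/d.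
clearbody a b c d; lra.
Qed.

Lemma nested_intervals (z s : nat -> R) :
  (forall n, z n <= z n.+1) -> (forall n, z n.+1 + s n.+1 <= z n + s n) ->
  (forall n, 0 <= s n) -> exists l, forall n, z n <= l <= z n + s n.
Proof.
move=> zi zs s0.
have mono m n : (m <= n)%N -> z m <= z n.
  by move=> /subnK <-; elim: (n - m)%N => [|k IH]//; rewrite addSn; exact: le_trans IH _.
have anti m n : (m <= n)%N -> z n + s n <= z m + s m.
  move=> /subnK <-; elim: (n - m)%N => [|k IH]//; rewrite addSn; exact: le_trans (zs _) IH.
have ub n : ubound (range z) (z n + s n).
  move=> _ [m _ <-]; have [mn|/ltnW nm] := leqP m n.
    by apply: le_trans (mono _ _ mn) _; rewrite lerDl.
  by apply: le_trans (anti _ _ nm); rewrite lerDl.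
exists (sup (range z)) => n; apply/andP; split.
  by apply: ub_le_sup; [exists (z 0%N + s 0%N); exact: ub|exists n].
by apply: ge_sup => //; exists (z 0%N); exists 0%N.
Qed.

Lemma half_pow_lt (s d : R) : 0 <= s -> 0 < d -> exists n, s / 2 ^+ n < d.
Proof.
move=> s0 d0; exists (Num.bound (s / d)); rewrite ltr_pdivrMr ?exprn_gt0//.
rewrite mulrC -ltr_pdivrMr//; apply: lt_le_trans (archi_boundP _) _.
  by rewrite divr_ge0// ltW.
by rewrite -natrX ler_nat ltnW// ltn_expl.
Qed.

(** Repeated quartering: a well chosen quarter retains a quarter of the contour, so the contour
    decays no faster than [4 ^- n]. At the common point of the squares differentiability forces it
    below any small multiple of the area, which is [s ^+ 2 * 4 ^- n]. *)
Lemma goursat u v x y s : 0 <= s ->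
  (forall x' y', in_square x y s x' y' -> cauchy_riemann u v x' y') ->
  contour u v x y s = 0.
Proof.
move=> s0 H.
have cnt x1 y1 s1 : x <= x1 -> y <= y1 -> x1 + s1 <= x + s -> y1 + s1 <= y + s ->
    continuous_square u x1 y1 s1 /\ continuous_square v x1 y1 s1.
  move=> h1 h2 h3 h4; split=> x' y' [h h'];
  by have [] := @cauchy_riemann_continuous u v x' y' (H _ _ _) => //; split; lra.
pose good (t : R * R * R) := let: (a, b, c) := t in
  [/\ 0 <= c, x <= a, y <= b, a + c <= x + s & b + c <= y + s].
(* [good t] is placed under the existential so that [choice] yields a total function that can be
   iterated. *)
have ex (t : R * R * R) : exists t' : R * R * R, good t ->
    [/\ good t', t'.2 = t.2 / 2, t.1.1 <= t'.1.1 <= t.1.1 + t.2 / 2,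
      t.1.2 <= t'.1.2 <= t.1.2 + t.2 / 2 &
      `|contour u v t.1.1 t.1.2 t.2| / 4 <= `|contour u v t'.1.1 t'.1.2 t'.2|].
  case: t => [[a b] c] /=; have [g|ng] := pselect (good (a, b, c)); last first.
    by exists (a, b, c).
  case: (g) => g1 g2 g3 g4 g5.
  have [uc vc] := cnt _ _ _ g2 g3 g4 g5.
  have [a' [b' [h1 h2 h3]]] := contour_quarter g1 uc vc.
  by exists (a', b', c / 2) => _; split => //=; split; lra.
have [nxt Hn] := choice ex.
pose st n := iter n nxt (x, y, s).
have gst n : good (st n).
  elim: n => [|n IH]; first by split; lra.
  by have [] := Hn (st n) IH.
have sst n : (st n).2 = s / 2 ^+ n.
  elim: n => [|n IH]; first by rewrite expr0 divr1.
  have [_ /= -> _ _ _] := Hn (st n) (gst n); rewrite IH exprS; field.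
  by rewrite expf_neq0.
have cst n : `|contour u v x y s| / 4 ^+ n <= `|contour u v (st n).1.1 (st n).1.2 (st n).2|.
  elim: n => [|n IH]; first by rewrite expr0 divr1.
  have [_ _ _ _ h] := Hn (st n) (gst n); apply: le_trans h.
  suff -> : `|contour u v x y s| / 4 ^+ n.+1 = `|contour u v x y s| / 4 ^+ n / 4 by lra.
  by rewrite exprS; field; rewrite expf_neq0.
have pos n : 0 <= (st n).2 by rewrite sst divr_ge0// exprn_ge0.
have [x0 hx0] : exists l, forall n, (st n).1.1 <= l <= (st n).1.1 + (st n).2.
  apply: nested_intervals => // n; have [_ /= h2 h _ _] := Hn (st n) (gst n); first by lra.
  by rewrite h2; lra.
have [y0 hy0] : exists l, forall n, (st n).1.2 <= l <= (st n).1.2 + (st n).2.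
  apply: nested_intervals => // n; have [_ /= h2 _ h _] := Hn (st n) (gst n); first by lra.
  by rewrite h2; lra.
apply/eqP; rewrite -normr_le0 leNgt; apply/negP => c0.
(* In the degenerate square [s = 0] the local bound already reads [0]. *)
have sp : 0 < s.
  rewrite lt_neqAle s0 andbT; apply/eqP => e0; move: c0.
  have := @contour_local u v x0 y0 (H _ _ (conj (hx0 0%N) (hy0 0%N))) 1 ltr01.
  move=> [d d0 /(_ x y s)]; rewrite -e0 lexx d0 expr0n/= mulr0 => h.
  have [uc vc] : continuous_square u x y s /\ continuous_square v x y s by apply: cnt.
  have := h isT (conj _ _) _ _; rewrite normr_le0 => hh.
  by have := hx0 0%N; have := hy0 0%N; rewrite /= -e0 => h1 h2; rewrite (eqP (hh _ _ _ _))// ?normr0 ?ltxx// e0.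
set D := `|contour u v x y s| in c0 cst.
(* With this [e] the local bound [8 * e * (s / 2 ^+ n) ^+ 2] is half of [D / 4 ^+ n]. *)
have e0 : 0 < D / (16 * s ^+ 2) by rewrite divr_gt0// mulr_gt0// exprn_gt0.
have [d d0 Hd] := contour_local (H _ _ (conj (hx0 0%N) (hy0 0%N))) e0.
have [n hn] := half_pow_lt s0 d0.
have [uc vc] : continuous_square u (st n).1.1 (st n).1.2 (st n).2 /\
               continuous_square v (st n).1.1 (st n).1.2 (st n).2.
  by move: (gst n); case: (st n) => [[a b] c] /= [*]; exact: cnt.
have := Hd (st n).1.1 (st n).1.2 (st n).2.
rewrite pos {1}sst hn => /(_ isT (conj (hx0 n) (hy0 n)) uc vc) /(le_trans (cst n)).
have -> : 8 * (D / (16 * s ^+ 2)) * (st n).2 ^+ 2 = D / 4 ^+ n / 2.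
  have -> : 4 ^+ n = 2 ^+ n * 2 ^+ n :> R by rewrite -exprMn; congr (_ ^+ _); lra.
  by rewrite sst; field; rewrite expf_neq0//= gt_eqF.
move=> h; suff : 0 < D / 4 ^+ n by move=> h'; lra.
by rewrite divr_gt0// exprn_gt0.
Qed.

End Goursat.

(** * Goursat's lemma with an exceptional point *)

Section Punctured.
Variable R : realType.
Implicit Types u v : R -> R -> R.

(** Continuity alone bounds the differences between opposite sides by [2], so the contour is of the
    order of the side. *)
Lemma contour_bound u v : continuous2 u 0 0 -> continuous2 v 0 0 ->
  exists2 d : R, 0 < d & forall r : R, 0 <= r < d ->
    continuous_square u (- r) (- r) (r + r) -> continuous_square v (- r) (- r) (r + r) ->
    `|contour u v (- r) (- r) (r + r)| <= 8 * r.
Proof.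
move=> u0 v0; have [d1 d10 h1] := u0 1 ltr01; have [d2 d20 h2] := v0 1 ltr01.
exists (Num.min d1 d2); first by rewrite lt_min d10.
move=> r /andP[r0]; rewrite lt_min => /andP[rd1 rd2] uc vc; rewrite /contour.
have near a b : - r <= a <= r -> - r <= b <= r ->
    `|u a b - u 0 0| <= 1 /\ `|v a b - v 0 0| <= 1.
  move=> ha hb.
  have la : `|a| <= r by rewrite ler_norml; lra.
  have lb : `|b| <= r by rewrite ler_norml; lra.
  have := h1 a b (le_lt_trans la rd1) (le_lt_trans lb rd1).
  have := h2 a b (le_lt_trans la rd2) (le_lt_trans lb rd2).
  by rewrite !add0r.
have rr : - r + (r + r) = r by ring.
rewrite rr.
set A := seg_int _ _ _; set B := seg_int _ _ _.
have hA : `|A - 0 * (r - - r)| <= 2 * (r - - r).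
  apply: seg_int_near; first lra.
    apply: (@continuous_onB R (u^~ (- r)) (u^~ r)); apply: continuous2_row => t ht;
    apply: uc; rewrite /in_square rr; lra.
  move=> t ht; have [|h _] := near t (- r) ht; first lra.
  have [|h' _] := near t r ht; first lra.
  move: h h'; rewrite !ler_norml => /andP[? ?] /andP[? ?]; apply/andP; split; lra.
have hB : `|B - 0 * (r - - r)| <= 2 * (r - - r).
  apply: seg_int_near; first lra.
    apply: (@continuous_onB R (v r) (v (- r))); apply: continuous2_col => t ht;
    apply: vc; rewrite /in_square rr; lra.
  move=> t ht; have [|_ h] := near (- r) t _ ht; first lra.
  have [|_ h'] := near r t _ ht; first lra.
  move: h h'; rewrite !ler_norml => /andP[? ?] /andP[? ?]; apply/andP; split; lra.
clearbody A B; move: hA hB; rewrite !ler_norml => /andP[? ?] /andP[? ?].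
by apply/andP; split; lra.
Qed.

(* The big square is made of sixteen squares of side [r]; the twelve outer ones
   avoid the origin and contribute nothing. *)
Lemma contour_halve u v r : 0 < r ->
  (forall x y, in_square (- (r + r)) (- (r + r)) (r + r + (r + r)) x y ->
    continuous2 u x y /\ continuous2 v x y) ->
  (forall x y, in_square (- (r + r)) (- (r + r)) (r + r + (r + r)) x y ->
    (x != 0) || (y != 0) -> cauchy_riemann u v x y) ->
  contour u v (- (r + r)) (- (r + r)) (r + r + (r + r)) = contour u v (- r) (- r) (r + r).
Proof.
move=> r0 cnt cr.
have cu x y s : - (r + r) <= x -> - (r + r) <= y -> x + s <= r + r -> y + s <= r + r ->
    continuous_square u x y s.
  by move=> *; move=> x' y' [? ?]; apply: (cnt _ _ _).1; split; lra.
have cv x y s : - (r + r) <= x -> - (r + r) <= y -> x + s <= r + r -> y + s <= r + r ->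
    continuous_square v x y s.
  by move=> *; move=> x' y' [? ?]; apply: (cnt _ _ _).2; split; lra.
have sub x y s : 0 <= s -> - (r + r) <= x -> - (r + r) <= y -> x + (s + s) <= r + r ->
   y + (s + s) <= r + r -> contour u v x y (s + s) = contour u v x y s +
    contour u v (x + s) y s + contour u v x (y + s) s + contour u v (x + s) (y + s) s.
  by move=> *; apply: contour_subdivide => //; [apply: cu|apply: cv].
have zero x y : - (r + r) <= x -> - (r + r) <= y -> x + r <= r + r -> y + r <= r + r ->
    [|| 0 < x, x + r < 0, 0 < y | y + r < 0] -> contour u v x y r = 0.
  move=> h1 h2 h3 h4 h; apply: goursat; first lra.
  move=> x' y' [? ?]; apply: cr; first by split; lra.
  by case/or4P: h => ?; apply/orP; [left|left|right|right]; apply/eqP; lra.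
rewrite (sub _ _ (r + r)); [|lra..].
rewrite !(sub _ _ r); [|lra..].
have e1 : - (r + r) + r = - r by ring.
have e2 : - (r + r) + (r + r) = 0 by ring.
have e3 : - r + r = 0 by ring.
rewrite !e1 !e2 !e3 !add0r.
rewrite (zero (- (r + r)) (- (r + r))); [|lra..].
rewrite (zero (- r) (- (r + r))); [|lra..].
rewrite (zero (- (r + r)) (- r)); [|lra..].
rewrite (zero 0 (- (r + r))); [|lra..].
rewrite (zero r (- (r + r))); [|lra..].
rewrite (zero r (- r)); [|lra..].
rewrite (zero (- (r + r)) 0); [|lra..].
rewrite (zero (- (r + r)) r); [|lra..].
rewrite (zero (- r) r); [|lra..].
rewrite (zero r 0); [|lra..].
rewrite (zero 0 r); [|lra..].
rewrite (zero r r); [|lra..].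
lra.
Qed.

(** Halving the square does not change the contour, and small squares have small contours. *)
Lemma goursat_punctured u v :
  (forall x y, in_square (- 1) (- 1) 2 x y -> continuous2 u x y /\ continuous2 v x y) ->
  (forall x y, in_square (- 1) (- 1) 2 x y -> (x != 0) || (y != 0) -> cauchy_riemann u v x y) ->
  contour u v (- 1) (- 1) 2 = 0.
Proof.
move=> cnt cr.
have cnt' n x y : in_square (- (2 ^- n)) (- (2 ^- n)) (2 ^- n + 2 ^- n) x y ->
    in_square (- 1) (- 1) (2 : R) x y.
  have : 2 ^- n <= 1 :> R by rewrite invf_le1 ?exprn_gt0// exprn_ege1// ler1n.
  by move=> h [? ?]; split; lra.
have dil n : contour u v (- 1) (- 1) 2 =
    contour u v (- (2 ^- n)) (- (2 ^- n)) (2 ^- n + 2 ^- n).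
  elim: n => [|n ->]; first by rewrite expr0 invr1.
  have e : 2 ^- n = 2 ^- n.+1 + 2 ^- n.+1 :> R.
    by rewrite exprS; field; rewrite expf_neq0.
  have := cnt' n; rewrite e => sub; apply: contour_halve.
  - by rewrite invr_gt0 exprn_gt0.
  - by move=> x y /sub; exact: cnt.
  - by move=> x y /sub; exact: cr.
have [||d d0 hd] := @contour_bound u v;
  do ?by [apply: (cnt _ _ _).1; split; lra|apply: (cnt _ _ _).2; split; lra].
apply/eqP; rewrite -normr_le0 leNgt; apply/negP => D0.
set D := `|_| in D0.
have [n hn] := @half_pow_lt R 1 (Num.min d (D / 8)) ler01 (ltac:(rewrite lt_min d0; lra)).
move: hn; rewrite div1r lt_min => /andP[nd nD].
have := hd (2 ^- n); rewrite nd invr_ge0 exprn_ge0// -dil => /(_ isT).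
have uc : continuous_square u (- 2 ^- n) (- 2 ^- n) (2 ^- n + 2 ^- n).
  by move=> x y /cnt'/cnt [].
have vc : continuous_square v (- 2 ^- n) (- 2 ^- n) (2 ^- n + 2 ^- n).
  by move=> x y /cnt'/cnt [].
move=> /(_ uc vc); rewrite -/D; lra.
Qed.

End Punctured.

(** * Continuity and differentiability over a normed field *)

Section ComplexDifferentiability.
Variable K : numFieldType.
Implicit Types (g q : K -> K) (z w : K).

(** Over [R[i]] the radius is a complex number, real because [0 < d]; [posc] extracts the real
    radius. *)
Definition near_pt z (Q : K -> Prop) :=
  exists2 d : K, 0 < d & forall w, `|w - z| < d -> Q w.

Definition cont_pt q z := forall e : K, 0 < e -> near_pt z (fun w => `|q w - q z| <= e).

(* Caratheodory's form: the difference quotient extends continuously to [z]. *)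
Definition cdiff g z := exists2 q, cont_pt q z &
  near_pt z (fun w => g w = g z + q w * (w - z)).

Lemma near_ptP z Q : near_pt z Q <-> nbhs z Q.
Proof.
split=> [[d d0 h]|/nbhs_ballP[d d0 h]].
  by apply/nbhs_ballP; exists d => // w; rewrite /ball/= distrC; exact: h.
by exists d => // w; rewrite distrC; exact: h.
Qed.

Lemma near_ptI z P Q : near_pt z P -> near_pt z Q -> near_pt z (fun w => P w /\ Q w).
Proof. by rewrite !near_ptP; exact: filterI. Qed.

Lemma near_ptS z (P Q : K -> Prop) : (forall w, P w -> Q w) -> near_pt z P -> near_pt z Q.
Proof. by move=> PQ [d d0 h]; exists d => // w /h /PQ. Qed.

Lemma near_pt_id z Q : near_pt z Q -> Q z.
Proof. by move=> [d d0]; apply; rewrite subrr normr0. Qed.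

Lemma cont_ptP q z : cont_pt q z <-> q w @[w --> z] --> q z.
Proof.
split=> [h|h e e0].
  apply: (proj2 (@cvgrPdist_le _ _ _ (nbhs z) (nbhs_filter z) _ _)) => e /h [d d0 hd].
  by apply/nbhs_ballP; exists d => // w; rewrite /ball/= distrC [in X in _ -> X]distrC; exact: hd.
have := proj1 (@cvgrPdist_le _ _ _ (nbhs z) (nbhs_filter z) _ _) h e e0.
rewrite nearE => /nbhs_ballP[d d0 hd].
by exists d => // w; rewrite distrC => /hd; rewrite distrC.
Qed.

Lemma cont_cst c z : cont_pt (fun=> c) z.
Proof. by move=> e e0; exists 1 => // w _; rewrite subrr normr0 ltW. Qed.

Lemma contD q q' z : cont_pt q z -> cont_pt q' z -> cont_pt (fun w => q w + q' w) z.
Proof. by move=> /cont_ptP h /cont_ptP h'; apply/cont_ptP; exact: (cvgD h h'). Qed.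

Lemma contM q q' z : cont_pt q z -> cont_pt q' z -> cont_pt (fun w => q w * q' w) z.
Proof. by move=> /cont_ptP h /cont_ptP h'; apply/cont_ptP; exact: (cvgM h h'). Qed.

Lemma contV q z : q z != 0 -> cont_pt q z -> cont_pt (fun w => (q w)^-1) z.
Proof. by move=> q0 /cont_ptP h; apply/cont_ptP; exact: (cvgV q0 h). Qed.

Lemma contN q z : cont_pt q z -> cont_pt (fun w => - q w) z.
Proof. by move=> /cont_ptP h; apply/cont_ptP; exact: (cvgN h). Qed.

Lemma cont_affine a c z : cont_pt (fun w => c + a * w) z.
Proof.
apply: contD; first exact: cont_cst.
by apply: contM; [exact: cont_cst|by move=> e e0; exists e => // w /ltW].
Qed.

Lemma cont_near q q' z : near_pt z (fun w => q w = q' w) -> cont_pt q z -> cont_pt q' z.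
Proof.
move=> qq' qc e /qc h; have qz := near_pt_id qq'.
by apply: near_ptS (near_ptI qq' h) => w [<-]; rewrite qz.
Qed.

Lemma cont_near_affine Q a c z : near_pt (c + a * z) Q -> near_pt z (fun w => Q (c + a * w)).
Proof.
move=> [d d0 h]; have d20 : 0 < d / 2 by rewrite divr_gt0.
apply: near_ptS (cont_affine a c z d20) => w wd; apply: h; apply: le_lt_trans wd _.
by rewrite ltr_pdivrMr// ltr_pMr// ltr1n.
Qed.

Lemma cdiff_near g g' z : near_pt z (fun w => g w = g' w) -> cdiff g z -> cdiff g' z.
Proof.
move=> gg' [q qc qE]; exists q => //; have gz := near_pt_id gg'.
by apply: near_ptS (near_ptI gg' qE) => w [<- ->]; rewrite gz.
Qed.

Lemma cdiff_cont g z : cdiff g z -> cont_pt g z.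
Proof.
move=> [q qc qE]; apply: (@cont_near (fun w => g z + q w * (- z + 1 * w))).
  by apply: near_ptS qE => w ->; ring.
apply: contD; first exact: cont_cst.
by apply: contM => //; exact: cont_affine.
Qed.

Lemma cdiff_cst c z : cdiff (fun=> c) z.
Proof.
exists (fun=> 0); first exact: cont_cst.
by exists 1 => // w _; rewrite mul0r addr0.
Qed.

Lemma cdiffM g g' z : cdiff g z -> cdiff g' z -> cdiff (fun w => g w * g' w) z.
Proof.
move=> [q qc qE] dg'; have g'c := cdiff_cont dg'; case: dg' => [q' q'c q'E].
exists (fun w => q w * g' w + g z * q' w).
  by apply: contD; apply: contM => //; exact: cont_cst.
by apply: near_ptS (near_ptI qE q'E) => w [-> ->]; ring.
Qed.

Lemma cdiffD g g' z : cdiff g z -> cdiff g' z -> cdiff (fun w => g w + g' w) z.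
Proof.
move=> [q qc qE] [q' q'c q'E]; exists (fun w => q w + q' w); first exact: contD.
by apply: near_ptS (near_ptI qE q'E) => w [-> ->]; ring.
Qed.

Lemma cdiff_affine g a c z : cdiff g (c + a * z) -> cdiff (fun w => g (c + a * w)) z.
Proof.
move=> [q qc qE]; exists (fun w => q (c + a * w) * a).
  apply: contM; last exact: cont_cst.
  by move=> e e0; exact: (@cont_near_affine (fun w => `|q w - q (c + a * z)| <= e) a c z (qc e e0)).
by apply: near_ptS (cont_near_affine qE) => w ->; ring.
Qed.

Lemma near_neq0 z : z != 0 -> near_pt z (fun w => w != 0).
Proof.
move=> z0; exists `|z|; first by rewrite normr_gt0.
by move=> w; apply: contraTneq => ->; rewrite sub0r normrN ltxx.
Qed.

Lemma cdiff_div g z : z != 0 -> cdiff g z -> cdiff (fun w => g w / w) z.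
Proof.
(* The slope of the inverse between [z] and [w] is [-1 / (z w)]; the leading [0] fits
   [cont_affine]. *)
move=> z0 dg; apply: cdiffM => //; exists (fun w => - (0 + z * w)^-1).
  by apply: contN; apply: contV; [rewrite add0r mulf_neq0|exact: cont_affine].
by apply: near_ptS (near_neq0 z0) => w w0; field; rewrite w0 z0.
Qed.

End ComplexDifferentiability.

(** * Identity theorem *)

Section ComplexPlane.
Variable R : realType.
Local Open Scope complex_scope.
Local Notation C := (R[i]).
Local Notation Re := complex.Re.
Local Notation Im := complex.Im.

Lemma normc_lt (z : C) (r : R) : 0 <= r ->
  (`|z| < r%:C) = (Re z ^+ 2 + Im z ^+ 2 < r ^+ 2).
Proof.
move=> r0; rewrite normc_def ltcR -{1}(ger0_norm r0) -sqrtr_sqr.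
have [->|rn] := eqVneq r 0.
  by rewrite expr0n/= sqrtr0 !ltNge sqrtr_ge0 addr_ge0 ?sqr_ge0.
by rewrite ltr_sqrt// exprn_even_gt0.
Qed.

Lemma Re_Im_le (z : C) (e : R) : `|z| <= e%:C -> `|Re z| <= e /\ `|Im z| <= e.
Proof.
rewrite normc_def lecR => h; split; apply: le_trans h; rewrite -sqrtr_sqr ler_sqrt ?addr_ge0 ?sqr_ge0//.
  by rewrite lerDl sqr_ge0.
by rewrite lerDr sqr_ge0.
Qed.

Lemma posc (e : C) : 0 < e -> exists2 r : R, 0 < r & e = r%:C.
Proof. by case: e => a b; rewrite ltcE /= => /andP[/eqP-> a0]; exists a. Qed.

Lemma near_pt_square (Q : C -> Prop) (x y : R) : near_pt (x +i* y) Q ->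
  exists2 d : R, 0 < d & forall a b : R, `|a| < d -> `|b| < d -> Q ((x + a) +i* (y + b)).
Proof.
move=> [_ /posc[d d0 ->] h]; exists (d / 2); first by rewrite divr_gt0.
move=> a b; rewrite !ltr_norml => /andP[a1 a2] /andP[b1 b2].
by apply: h; rewrite normc_lt ?ltW//=; nra.
Qed.

Lemma cont_continuous2 (g : C -> C) (x y : R) : cont_pt g (x +i* y) ->
  continuous2 (fun x y => Re (g (x +i* y))) x y /\
  continuous2 (fun x y => Im (g (x +i* y))) x y.
Proof.
move=> gc; split=> e e0.
all: have e0' : 0 < e%:C by rewrite ltcR.
all: have [d d0 h] := near_pt_square (gc _ e0'); exists d => // a b /h{}h /h /Re_Im_le.
all: by case: (g _) => ? ?; case: (g _) => ? ? /= [].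
Qed.

Lemma cdiff_cauchy_riemann (g : C -> C) (x y : R) : cdiff g (x +i* y) ->
  cauchy_riemann (fun x y => Re (g (x +i* y))) (fun x y => Im (g (x +i* y))) x y.
Proof.
move=> [q qc qE]; exists (Re (q (x +i* y))), (Im (q (x +i* y))) => e e0.
have e0' : 0 < e%:C :> C by rewrite ltcR.
have [d d0 h] := near_pt_square (near_ptI (qc _ e0') qE); exists d => // a b ha hb.
have [/Re_Im_le + ->] := h a b ha hb.
case: (g _) (q _) (q _) => g1 g2 [p1 p2] [p1' p2'] /= [h1 h2].
have k1 := ler_wpM2r (normr_ge0 a) h1; have k2 := ler_wpM2r (normr_ge0 b) h2.
have k3 := ler_wpM2r (normr_ge0 b) h1; have k4 := ler_wpM2r (normr_ge0 a) h2.
move: k1 k2 k3 k4; rewrite -!normrM => k1 k2 k3 k4; split.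
  rewrite (_ : _ - _ = (p1' - p1) * a - (p2' - p2) * b); last by ring.
  by apply: le_trans (ler_normB _ _) _; rewrite mulrDr lerD.
rewrite (_ : _ - _ = (p2' - p2) * a + (p1' - p1) * b); last by ring.
by apply: le_trans (ler_normD _ _) _; rewrite mulrDr lerD.
Qed.

(** The integral is [pi / 2], but any positive lower bound will do: the integrand lies in
    [[1/2, 1]]. *)
Lemma seg_int_poisson : 1 <= seg_int (fun t : R => (1 + t ^+ 2)^-1) (- 1) 1.
Proof.
have pos (t : R) : 0 < 1 + t ^+ 2 by have := sqr_ge0 t; lra.
have := @seg_int_near R (fun t => (1 + t ^+ 2)^-1) (- 1) 1 1 (1 / 2).
have -> : (- 1 <= 1 :> R) by lra.
move=> /(_ isT) h; have {h}: `|seg_int (fun t : R => (1 + t ^+ 2)^-1) (- 1) 1 - 1 * (1 - -1)| <= 1 / 2 * (1 - -1).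
  apply: h => [t ht|t ht].
    apply/cont_ptP; apply: contV; first by rewrite gt_eqF.
    apply: contD; first exact: cont_cst.
    have ti : cont_pt (fun t : R => t) t by move=> e e0; exists e => // w /ltW.
    exact: contM.
  have t1 : t ^+ 2 <= 1 by nra.
  have h1 : (1 + t ^+ 2)^-1 <= 1 by rewrite invf_le1// lerDl sqr_ge0.
  have h2 : 1 / 2 <= (1 + t ^+ 2)^-1 by rewrite div1r lef_pV2 ?posrE//; lra.
  by rewrite ler_norml; lra.
rewrite ler_norml; lra.
Qed.

(* Cauchy's formula with [h w = (k w - k 0) / w]: on the boundary [h = - k 0 / w],
   whose contour integral is [-4 i J (k 0)] with [J = int_(-1)^1 dt / (1 + t^2)]. *)
Lemma Im_square_center (k : C -> C) :
  (forall x y, in_square (- 1) (- 1) 2 x y -> cdiff k (x +i* y)) ->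
  (forall t, - 1 <= t <= 1 -> [/\ k (t +i* (- 1)) = 0, k (t +i* 1) = 0,
    k ((- 1) +i* t) = 0 & k (1 +i* t) = 0]) ->
  Im (k 0) = 0.
Proof.
move=> kd k0.
have in0 : in_square (- 1) (- 1) 2 (0 : R) 0 by split; lra.
have [q qc qE] := kd 0 0 in0.
pose h (w : C) : C := if w == 0 then q 0 else (k w - k 0) / w.
have hc : cont_pt h 0.
  apply: cont_near qc; apply: near_ptS qE => w; rewrite /h.
  case: eqP => [-> //|/eqP w0 ->]; rewrite subr0; field; exact: w0.
have hd (z : C) : z != 0 -> cdiff k z -> cdiff h z.
  move=> z0 dk; apply: (@cdiff_near _ (fun w => (k w + - k 0) / w)).
    by apply: near_ptS (near_neq0 z0) => w /negPf w0; rewrite /h w0.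
  by apply: cdiff_div => //; apply: cdiffD => //; exact: cdiff_cst.
set u := fun x y => Re (h (x +i* y)); set v := fun x y => Im (h (x +i* y)).
have := @goursat_punctured R u v.
have nz (x y : R) : (x != 0) || (y != 0) -> (x +i* y : C) != 0.
  by rewrite eq_complex /= negb_and.
have uv x y : in_square (- 1) (- 1) 2 x y -> continuous2 u x y /\ continuous2 v x y.
  move=> hxy; apply: cont_continuous2.
  have [xy0|] := boolP ((x != 0) || (y != 0)).
    by apply: cdiff_cont; apply: hd; [exact: nz|exact: kd].
  by rewrite negb_or !negbK => /andP[/eqP-> /eqP->].
move=> /(_ uv) G; have {G} : contour u v (- 1) (- 1) 2 = 0.
  by apply: G => x y hxy xy0; apply: cdiff_cauchy_riemann; apply: hd; [exact: nz|exact: kd].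
rewrite /contour (_ : - 1 + 2 = 1 :> R); last by ring.
have pos (t : R) : 1 + t ^+ 2 != 0 by rewrite gt_eqF//; have := sqr_ge0 t; lra.
have oc : continuous_on (fun t : R => (1 + t ^+ 2)^-1) (- 1) 1.
  move=> t ht; apply/cont_ptP; apply: contV => //.
  apply: contD; first exact: cont_cst.
  have ti : cont_pt (fun t : R => t) t by move=> e e0; exists e => // w /ltW.
  exact: contM.
have n1 : (1 : R) != 0 by exact: oner_neq0.
have n2 : (- 1 : R) != 0 by rewrite oppr_eq0.
set b := Im (k 0).
(* [contour] is the real part of [-4 i J (k 0)], that is [4 b J]: only the imaginary part of [k 0]
   is seen. [square_center] gets the real part by applying this to [i k]. *)
have E1 t : - 1 <= t <= 1 -> u t (- 1) - u t 1 = 2 * b * (1 + t ^+ 2)^-1.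
  move=> ht; have [k1 k2 _ _] := k0 t ht; rewrite /u /h.
  rewrite (negPf (nz t (- 1) _)) ?n2 ?orbT// (negPf (nz t 1 _)) ?n1 ?orbT//.
  rewrite k1 k2 /b; case: (k 0) => a b' /=.
  by field; rewrite ?pos //; have := pos t; rewrite addrC.
have E2 t : - 1 <= t <= 1 -> v 1 t - v (- 1) t = - (2 * b) * (1 + t ^+ 2)^-1.
  move=> ht; have [_ _ k1 k2] := k0 t ht; rewrite /v /h.
  rewrite (negPf (nz (- 1) t _)) ?n2// (negPf (nz 1 t _)) ?n1//.
  rewrite k1 k2 /b; case: (k 0) => a b' /=.
  by field; rewrite ?pos //; have := pos t; rewrite addrC.
rewrite (eq_seg_int E1) (eq_seg_int E2) !seg_intZ//.
have := seg_int_poisson; set J := seg_int _ _ _ => J1 h0.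
have : b * J = 0 by lra.
by move/eqP; rewrite mulf_eq0 => /orP[/eqP//|/eqP]; lra.
Qed.

End ComplexPlane.

Section IdentityTheorem.
Variable R : realType.
Local Open Scope complex_scope.
Local Notation C := (R[i]).
Local Notation Re := complex.Re.
Local Notation Im := complex.Im.

Lemma square_center (k : C -> C) :
  (forall x y, in_square (- 1) (- 1) 2 x y -> cdiff k (x +i* y)) ->
  (forall t, - 1 <= t <= 1 -> [/\ k (t +i* (- 1)) = 0, k (t +i* 1) = 0,
    k ((- 1) +i* t) = 0 & k (1 +i* t) = 0]) ->
  k 0 = 0.
Proof.
move=> kd k0; have i0 := Im_square_center kd k0.
have := @Im_square_center R (fun w => (0 +i* 1) * k w).
have -> : Im ((0 +i* 1) * k 0) = Re (k 0) by case: (k 0) => a b /=; ring.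
move=> r0; case: (k 0) i0 r0 => a b /= -> -> //.
- by move=> x y /kd dk; apply: cdiffM => //; exact: cdiff_cst.
- by move=> t /k0[-> -> -> ->]; rewrite mulr0.
Qed.

(* The product of [g] over the four rotations by [i] vanishes on the whole
   boundary of the square as soon as [g] vanishes on one side. *)
Lemma vanish_center (g : C -> C) (c a : C) :
  (forall x y, in_square (- 1) (- 1) 2 x y -> cdiff g (c + a * (x +i* y))) ->
  (forall t, - 1 <= t <= 1 -> g (c + a * (t +i* (- 1))) = 0) ->
  g c = 0.
Proof.
move=> gd g0; pose I : C := 0 +i* 1.
pose k w := g (c + a * w) * g (c + (a * I) * w) * (g (c + (- a) * w) * g (c + (- a * I) * w)).
have : k 0 = 0.
  apply: square_center => [x y [hx hy]|t ht].
    apply: cdiffM; apply: cdiffM; apply: cdiff_affine.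
    - exact: gd.
    - rewrite (_ : a * I * (x +i* y) = a * ((- y) +i* x)).
        by apply: gd; split; lra.
      by rewrite -mulrA /I; congr (_ * _); apply/eqP; rewrite eq_complex /=; apply/andP; split; apply/eqP; ring.
    - rewrite (_ : - a * (x +i* y) = a * ((- x) +i* (- y))).
        by apply: gd; split; lra.
      by rewrite mulNr -mulrN.
    - rewrite (_ : - a * I * (x +i* y) = a * (y +i* (- x))).
        by apply: gd; split; lra.
      by rewrite mulNr mulNr -mulrN -mulrA; congr (_ * _); apply/eqP; rewrite eq_complex /=; apply/andP; split; apply/eqP; ring.
  have ht' : - 1 <= - t <= 1 by lra.
  have e (z w : C) : z = w -> g (c + a * w) = 0 -> g (c + a * z) = 0 by move=> ->.
  split; rewrite /k.
  - by rewrite g0// !mul0r.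
  - rewrite (_ : - a * (t +i* 1) = a * ((- t) +i* (- 1))) ?g0 ?mul0r ?mulr0//.
    by rewrite mulNr -mulrN.
  - rewrite (_ : a * I * (- 1 +i* t) = a * ((- t) +i* (- 1))) ?g0 ?mul0r ?mulr0 ?mul0r//.
    by rewrite -mulrA /I; congr (_ * _); apply/eqP; rewrite eq_complex /=; apply/andP; split; apply/eqP; ring.
  - rewrite (_ : - a * I * (1 +i* t) = a * (t +i* (- 1))) ?g0 ?mul0r ?mulr0//.
    by rewrite mulNr mulNr -mulrN -mulrA; congr (_ * _); apply/eqP; rewrite eq_complex /=; apply/andP; split; apply/eqP; ring.
(* All four factors of [k 0] equal [g c]. *)
by rewrite /k !mulr0 !addr0 => /eqP; rewrite !mulf_eq0 !orbb => /eqP.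
Qed.

(** Take the square centred at [w], of side [|w - c|], one side of which has the midpoint of [c] and
    [w] as its midpoint and is perpendicular to [w - c]. This side is within [|w - c| / sqrt 2 < r]
    of [c], since [4 / 3 < sqrt 2]; the whole square is within [sqrt (5 / 2) |w - c| < 3 r]. *)
Lemma vanish_ball (g : C -> C) (c : C) (r : R) : 0 < r ->
  (forall w, `|w - c| < (3 * r)%:C -> cdiff g w) ->
  (forall w, `|w - c| < r%:C -> g w = 0) ->
  forall w, `|w - c| < (4 / 3 * r)%:C -> g w = 0.
Proof.
move=> r0 gd g0 w; have [wr _|wr] := boolP (`|w - c| < r%:C); first exact: g0.
have r3 : 0 <= 3 * r by lra.
have r43 : 0 <= 4 / 3 * r by lra.
move: wr; rewrite (normc_lt _ (ltW r0)) (normc_lt _ r43) -leNgt.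
case E : (w - c) => [p q] /= pq1 pq2.
have wE : w = c + (p +i* q) by rewrite -E addrC subrK.
apply: (@vanish_center g w ((q / 2) +i* (- p / 2))) => [x y [hx hy]|t ht].
  apply: gd; rewrite wE normc_lt// addrAC [c + _]addrC addrK /=.
  have -> : (p + (q / 2 * x - - p / 2 * y)) ^+ 2 + (q + (q / 2 * y + - p / 2 * x)) ^+ 2
    = (p ^+ 2 + q ^+ 2) * ((1 + y / 2) ^+ 2 + (x / 2) ^+ 2) by ring.
  have h : (1 + y / 2) ^+ 2 + (x / 2) ^+ 2 <= 5 / 2 by nra.
  have pq0 : 0 <= p ^+ 2 + q ^+ 2 by rewrite addr_ge0// sqr_ge0.
  have := ler_wpM2l pq0 h; nra.
apply: g0; rewrite wE (normc_lt _ (ltW r0)) addrAC [c + _]addrC addrK /=.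
have -> : (p + (q / 2 * t - - p / 2 * -1)) ^+ 2 + (q + (q / 2 * -1 + - p / 2 * t)) ^+ 2
    = (p ^+ 2 + q ^+ 2) * ((1 / 2) ^+ 2 + (t / 2) ^+ 2) by field.
have h : (1 / 2) ^+ 2 + (t / 2) ^+ 2 <= 1 / 2 :> R by nra.
have pq0 : 0 <= p ^+ 2 + q ^+ 2 by rewrite addr_ge0// sqr_ge0.
have := ler_wpM2l pq0 h; nra.
Qed.

Lemma vanish_chain (g : C -> C) (c v : C) (rho : R) (n : nat) : 0 < rho ->
  (forall j w, (j <= n)%N -> `|w - (c + v *+ j)| < rho%:C -> cdiff g w) ->
  `|v| <= (rho / 9)%:C ->
  (forall w, `|w - c| < (rho / 3)%:C -> g w = 0) ->
  forall w, `|w - (c + v *+ n)| < (rho / 3)%:C -> g w = 0.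
Proof.
move=> r0 + v9 g0; elim: n => [|n IH] gd; first by rewrite mulr0n addr0.
have gn : forall w, `|w - (c + v *+ n)| < (rho / 3)%:C -> g w = 0.
  by apply: IH => j w jn; apply: gd; exact: leqW.
move=> w hw; apply: (@vanish_ball g (c + v *+ n) (rho / 3)) => //; first by lra.
  move=> w'; rewrite mulrC divfK//; exact: gd.
have -> : w - (c + v *+ n) = (w - (c + v *+ n.+1)) + v by rewrite mulrSr; ring.
apply: le_lt_trans (ler_normD _ _) _; apply: lt_le_trans (ltr_leD hw v9) _.
by rewrite -rmorphD lecR; lra.
Qed.

Definition locally_finite (S : set C) := forall z, exists2 e : R, 0 < e &
  forall w, S w -> w != z -> e%:C <= `|w - z|.

(** Compactness of [[a, b]] makes the local isolation radii uniform. The axis itself is excluded by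
    [0 < y], as [S] may meet it. *)
Lemma locally_finite_strip (S : set C) (a b : R) : locally_finite S ->
  exists2 h : R, 0 < h & forall x y, a <= x <= b -> 0 < y < h -> ~ S (x +i* y).
Proof.
move=> Sf; have := @segment_compact R a b.
move=> /compact_near_coveringP/(_ R (0^'+)%classic
  (fun h x => forall y, 0 < y < h -> ~ S (x +i* y)) _).
case.
  move=> x _; have [e e0 he] := Sf (x%:C).
  exists (ball x (e / 2), [set h | h < e / 2]).
    split=> /=; first by apply: nbhsx_ballx; rewrite divr_gt0.
    by apply: nbhs_right_lt; rewrite divr_gt0.
  move=> [x' h] /= [hx hh] y /andP[y0 yh] Sxy.
  have := he _ Sxy; rewrite eq_complex /= negb_and (gt_eqF y0) orbT => /(_ isT).
  have lt : `|x' +i* y - x%:C| < e%:C :> C.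
    rewrite normc_lt ?ltW//=; move: hx; rewrite /ball/= ltr_norml => /andP[h1 h2].
    by rewrite subr0; nra.
  by move=> /(lt_le_trans lt); rewrite ltxx.
move=> h h0 hS; exists (h / 2) => [|x y hx hy]; first by rewrite divr_gt0.
apply: (hS (h / 2)) hy => //=.
- by rewrite sub0r normrN gtr0_norm ?divr_gt0//; move: h0 => /=; lra.
- by move: h0 => /=; lra.
Qed.

Lemma sqr_sum_lt (p q r : R) : 0 < r -> p ^+ 2 + q ^+ 2 < r ^+ 2 ->
  - r < p < r /\ - r < q < r.
Proof.
move=> r0 h.
have aux (a : R) : a ^+ 2 < r ^+ 2 -> - r < a < r.
  by move=> ha; rewrite -ltr_norml -ltr_sqr ?nnegrE ?(ltW r0)// real_normK ?num_real.
by split; apply: aux; apply: le_lt_trans h; rewrite ?lerDl ?lerDr sqr_ge0.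
Qed.

(** For every small [y > 0] a chain of discs at height [y] carries the vanishing from above [x1] to
    above [x]; continuity at [x] then lets [y] tend to [0]. *)
Lemma identity_real_line (g : C -> C) (S : set C) (A : R) : locally_finite S ->
  (forall z, ~ S z -> cdiff g z) -> (forall x : R, A < x -> g x%:C = 0) ->
  forall x : R, ~ S x%:C -> g x%:C = 0.
Proof.
move=> Sf gd gA x xS.
(* [A + 1] may belong to [S]; a shift by at most half its isolation radius gives a box free of
   [S]. *)
have [x1 [e e0 [Ae Se]]] : exists x1 : R, exists2 e : R, 0 < e &
    A + e < x1 /\ forall p q, `|p - x1| < e / 2 -> `|q| < e / 2 -> ~ S (p +i* q).
  have [e0 e00 he] := Sf ((A + 1)%:C).
  pose e := Num.min e0 1 / 2.
  have ee0 : 0 < e by rewrite divr_gt0// lt_min e00/=.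
  have [m1 m2] : e <= e0 / 2 /\ e <= 1 / 2.
    by split; rewrite /e ler_pM2r// ge_min lexx ?orbT.
  exists (A + 1 + e), e => //; split; first by lra.
  move=> p q; rewrite !ltr_norml => /andP[h1 h2] /andP[h3 h4] Spq.
  have := he _ Spq; rewrite eq_complex /= negb_and.
  have -> /= : p != A + 1 by rewrite gt_eqF//; lra.
  move=> /(_ isT).
  have lt : `|p +i* q - (A + 1)%:C| < e0%:C :> C by rewrite normc_lt ?ltW//= subr0; nra.
  by move=> /(lt_le_trans lt); rewrite ltxx.
have [h h0 hS] := locally_finite_strip (Num.min x x1 - 1) (Num.max x x1 + 1) Sf.
(* For [y < k]: [h / 2] keeps the discs of radius [y] inside the strip, [1] keeps them above the
   widened interval, and [e / 8] keeps the starting squares in the box around [x1]. *)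
pose k := Num.min (Num.min (h / 2) 1) (e / 8).
have k0 : 0 < k by rewrite !lt_min ltr01 !divr_gt0.
have line y : 0 < y < k -> g (x +i* y) = 0.
  rewrite !lt_min => /and3P[y0 /andP[yh y1] ye].
  (* The square centred at [w] with half-side the height of [w] stands on the real axis, where [g]
     vanishes. *)
  have g0 w : `|w - (x1 +i* y)| < (y / 3)%:C -> g w = 0.
    case: w => p q; rewrite normc_lt/=; last by lra.
    move=> pq.
    have [|/andP[p1 p2] /andP[q1 q2]] := sqr_sum_lt _ pq; first by lra.
    apply: (@vanish_center g _ q%:C) => [x' y' [hx hy]|t ht] /=.
      have -> : (p +i* q + q%:C * (x' +i* y')) = (p + q * x') +i* (q + q * y').
        by apply/eqP; rewrite eq_complex /=; apply/andP; split; apply/eqP; ring.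
      apply: gd; apply: Se; rewrite ltr_norml.
        by apply/andP; split; nra.
      by apply/andP; split; nra.
    have -> : (p +i* q + q%:C * (t +i* (- 1))) = (p + q * t)%:C.
      by apply/eqP; rewrite eq_complex /=; apply/andP; split; apply/eqP; ring.
    by apply: gA; nra.
  pose N := (Num.bound (9 * `|x - x1| / y)).+1.
  have N0 : 0 < N%:R :> R by rewrite ltr0n.
  have NB : 9 * `|x - x1| / y <= N%:R.
    apply: ltW; apply: lt_le_trans (archi_boundP _) _; last by rewrite ler_nat.
    by rewrite divr_ge0 ?mulr_ge0// ltW.
  pose v := (x - x1) / N%:R.
  have vj j : (v%:C : C) *+ j = (v * j%:R)%:C by rewrite -rmorphMn/= mulr_natr.
  have := @vanish_chain g (x1 +i* y) v%:C y N y0.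
  have -> : `|v%:C : C| <= (y / 9)%:C.
    rewrite normc_def lecR /= expr0n addr0 sqrtr_sqr /v normrM normfV (gtr0_norm N0).
    rewrite ler_pdivrMr//; move: NB; rewrite ler_pdivrMr//; lra.
  move=> chain; apply: (chain _ isT g0); last first.
    rewrite vj (_ : _ - _ = 0).
      by rewrite normr0 ltcR divr_gt0.
    apply/eqP; rewrite eq_complex /=; apply/andP; split; apply/eqP; last by ring.
    by rewrite /v divfK ?gt_eqF//; ring.
  move=> j [p q] jN; rewrite vj normc_lt ?(ltW y0)//= => pq.
  have j1 : 0 <= (j%:R / N%:R : R) <= 1.
    by rewrite divr_ge0 ?ler0n//= ler_pdivrMr// mul1r ler_nat.
  set l := j%:R / N%:R in j1.
  have vl : v * j%:R = (x - x1) * l by rewrite /v /l mulrAC mulrA.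
  rewrite vl in pq.
  apply: gd; apply: hS; last by have [_ /andP[? ?]] := sqr_sum_lt y0 pq; apply/andP; split; lra.
  have [/andP[p1 p2] /andP[q1 q2]] := sqr_sum_lt y0 pq.
  have [m1 m2] : Num.min x x1 <= x /\ Num.min x x1 <= x1 by rewrite !ge_min !lexx orbT.
  have [m3 m4] : x <= Num.max x x1 /\ x1 <= Num.max x x1 by rewrite !le_max !lexx orbT.
  by apply/andP; split; nra.
apply/eqP/negPn/negP => gx0.
have e' : 0 < `|g x%:C| / 2 by rewrite divr_gt0// normr_gt0.
have [d d0 hd] := near_pt_square (cdiff_cont (gd _ xS) e').
pose y := Num.min k d / 2.
have [y0 yk yd] : [/\ 0 < y, y < k & y < d].
  have m0 : 0 < Num.min k d by rewrite lt_min k0.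
  have mk : Num.min k d <= k by rewrite ge_min lexx.
  have md : Num.min k d <= d by rewrite ge_min lexx orbT.
  by rewrite /y; split; lra.
have := hd 0 y; rewrite normr0 d0 gtr0_norm// yd => /(_ isT isT).
rewrite addr0 add0r line ?y0// sub0r normrN ler_pdivlMr// -subr_ge0 => hh.
have : `|g x%:C| * 2 - `|g x%:C| <= 0 by rewrite subr_le0; move: hh; rewrite subr_ge0.
by rewrite (_ : _ - _ = `|g x%:C|); [rewrite normr_le0; exact/negP|ring].
Qed.

End IdentityTheorem.

(** * Moments and the functional equation on the positive axis *)

Section Bernstein.
Variable R : realType.
Implicit Types (phi : nat -> R) (u v : R).

(* Bernstein polynomial of degree [n], built by Pascal's recursion. *)
Fixpoint bernstein n phi : {poly R} :=
  if n is n'.+1 then (1 - 'X) * bernstein n' phi + 'X * bernstein n' (fun k => phi k.+1)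
  else (phi 0%N)%:P.

(* The quadratic bound is propagated exactly by the recursion: this is the
   variance [n u (1 - u)] of the binomial law. *)
Lemma bernstein_near n phi c a b d u : 0 <= u <= 1 ->
  (forall k, (k <= n)%N -> `|phi k - c| <= a + b * (k%:R - d) ^+ 2) ->
  `|(bernstein n phi).[u] - c| <= a + b * (n%:R * u * (1 - u) + (n%:R * u - d) ^+ 2).
Proof.
move=> /andP[u0 u1]; elim: n phi d => [|n IH] phi d H /=.
  by have := H 0%N isT; rewrite hornerC !mul0r !add0r.
rewrite !hornerE.
have h1 := IH phi d (fun k kn => H k (leqW kn)).
have h2 : `|(bernstein n (fun k => phi k.+1)).[u] - c| <=
    a + b * (n%:R * u * (1 - u) + (n%:R * u - (d - 1)) ^+ 2).
  apply: IH => k kn; have := H k.+1 kn.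
  by rewrite -natr1 (_ : k%:R + 1 - d = k%:R - (d - 1)); last by ring.
set p := (bernstein n phi).[u] in h1 *; set q := _.[u] in h2 *.
rewrite (_ : _ - c = (1 - u) * (p - c) + u * (q - c)); last by ring.
apply: le_trans (ler_normD _ _) _; rewrite !normrM (ger0_norm u0) ger0_norm; last by lra.
have u1' : 0 <= 1 - u by lra.
have k1 := ler_wpM2l u1' h1; have k2 := ler_wpM2l u0 h2.
apply: le_trans (lerD k1 k2) _; rewrite le_eqVlt; apply/orP; left; apply/eqP.
by rewrite -natr1; ring.
Qed.

(** The inequality [L d <= e / 2 + (L d) ^ 2 / (2 e)] turns the Lipschitz bound into the quadratic
    one that [bernstein_near] propagates; the variance [u (1 - u) / n] adds at most [e / 2] once
    [n >= (L / e) ^ 2]. *)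
Lemma lipschitz_poly_approx (g : R -> R) (L e : R) : 0 < L -> 0 < e ->
  (forall u v, 0 <= u <= 1 -> 0 <= v <= 1 -> `|g u - g v| <= L * `|u - v|) ->
  exists p : {poly R}, forall u, 0 <= u <= 1 -> `|p.[u] - g u| <= e.
Proof.
move=> L0 e0 gL; pose n := (Num.bound (L ^+ 2 / e ^+ 2)).+1.
have n0 : 0 < n%:R :> R by rewrite ltr0n.
have nB : L ^+ 2 / e ^+ 2 <= n%:R.
  apply: ltW; apply: lt_le_trans (archi_boundP _) _; last by rewrite ler_nat.
  by rewrite divr_ge0// exprn_ge0// ltW.
exists (bernstein n (fun k => g (k%:R / n%:R))) => u u01.
have := @bernstein_near n (fun k => g (k%:R / n%:R)) (g u) (e / 2)
  (L ^+ 2 / (2 * e * n%:R ^+ 2)) (n%:R * u) u u01.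
move=> H; apply: le_trans (H _) _ => [k kn|].
  have kn01 : 0 <= (k%:R / n%:R : R) <= 1.
    by rewrite divr_ge0 ?ler0n//= ler_pdivrMr// mul1r ler_nat.
  apply: le_trans (gL _ _ kn01 u01) _.
  have -> : L ^+ 2 / (2 * e * n%:R ^+ 2) * (k%:R - n%:R * u) ^+ 2
      = (L * `|k%:R / n%:R - u|) ^+ 2 / (2 * e).
    by rewrite exprMn real_normK ?num_real//; field; rewrite !gt_eqF.
  set t := L * _.
  have : 0 <= (t - e) ^+ 2 / (2 * e) by rewrite divr_ge0 ?sqr_ge0// mulr_ge0// ltW.
  rewrite (_ : _ / _ = e / 2 + t ^+ 2 / (2 * e) - t); last by field; rewrite gt_eqF.
  by lra.
rewrite subrr expr0n/= addr0.
have -> : L ^+ 2 / (2 * e * n%:R ^+ 2) * (n%:R * u * (1 - u))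
    = (L ^+ 2 / e ^+ 2 / n%:R) * (e / 2 * (u * (1 - u))).
  by field; rewrite !gt_eqF.
have h1 : L ^+ 2 / e ^+ 2 / n%:R <= 1 by rewrite ler_pdivrMr// mul1r.
have h2 : 0 <= L ^+ 2 / e ^+ 2 / n%:R.
  by rewrite !divr_ge0// ?exprn_ge0// ltW.
have [q0 q1] : 0 <= u * (1 - u) /\ u * (1 - u) <= 1 by split; nra.
have h3 : 0 <= e / 2 * (u * (1 - u)) <= e / 2 by nra.
set x := _ / _ / _ in h1 h2 *; set y := _ * _ in h3 *; nra.
Qed.

(** By homogeneity [w = u / v] reduces this to [1 - w ^ y <= n (1 - w)], which follows from
    [w ^ n <= w ^ y] and a geometric sum; the factor [v ^ y] is at most [v] because [1 <= y]. *)
Lemma powR_lipschitz (y : R) : 1 <= y -> exists2 L : R, 0 < L &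
  forall u v, 0 <= u <= 1 -> 0 <= v <= 1 -> `|u `^ y - v `^ y| <= L * `|u - v|.
Proof.
move=> y1; exists (Num.bound y)%:R.
  by apply: (@le_lt_trans _ _ y); [|apply: archi_boundP]; lra.
have yn : y <= (Num.bound y)%:R by apply/ltW/archi_boundP; lra.
set n := Num.bound y in yn *.
suff H u v : 0 <= u -> u <= v -> v <= 1 -> v `^ y - u `^ y <= n%:R * (v - u).
  move=> u v /andP[u0 u1] /andP[v0 v1]; have [uv|/ltW vu] := leP u v.
    rewrite distrC ger0_norm; last by rewrite subr_ge0 ge0_ler_powR ?nnegrE//; lra.
    by rewrite distrC ger0_norm ?subr_ge0//; exact: H.
  rewrite ger0_norm; last by rewrite subr_ge0 ge0_ler_powR ?nnegrE//; lra.
  by rewrite ger0_norm ?subr_ge0//; exact: H.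
move=> u0 uv v1; have [v0|vn0] := eqVneq v 0.
  rewrite v0 in uv *; have -> : u = 0 by lra.
  by rewrite !subrr mulr0 lexx.
have v0 : 0 < v by rewrite lt_neqAle eq_sym vn0; lra.
have [->|un0] := eqVneq u 0.
  rewrite powR0; last by rewrite gt_eqF//; lra.
  rewrite !subr0; apply: (@le_trans _ _ v); first by apply: ge1r_powR => //; rewrite v0.
  by apply: ler_peMl; lra.
have {un0}u0 : 0 < u by rewrite lt_neqAle eq_sym un0.
pose w := u / v.
have uE : u = v * w by rewrite /w mulrC divfK// gt_eqF.
have w0 : 0 < w by rewrite divr_gt0.
have w1 : w <= 1 by rewrite ler_pdivrMr// mul1r.
rewrite uE powRM ?(ltW v0) ?(ltW w0)//.
have hw : 1 - w `^ y <= n%:R * (1 - w).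
  apply: (@le_trans _ _ (1 - w ^+ n)).
    rewrite lerD2l lerN2 -powR_mulrn ?(ltW w0)//.
    by apply: ger_powR => //; rewrite w0.
  rewrite -[1 in leLHS](expr1n _ n) subrXX mulrC ler_wpM2r ?subr_ge0//.
  have -> : n%:R = \sum_(i < n) 1 :> R by rewrite sumr_const card_ord.
  apply: ler_sum => i _.
  by rewrite expr1n mul1r exprn_ile1// (ltW w0).
have vy : v `^ y <= v by apply: ge1r_powR => //; rewrite v0.
have -> : v `^ y - v `^ y * w `^ y = v `^ y * (1 - w `^ y) by ring.
have -> : n%:R * (v - v * w) = v * (n%:R * (1 - w)) by ring.
apply: ler_pM => //; first exact: powR_ge0.
rewrite subr_ge0 -[leRHS](powRr0 w); apply: ger_powR; [by rewrite w0|lra].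
Qed.

End Bernstein.

(** * The recurrent sequence and its growth *)

Section Sequence.
Variable R : realType.
Variable m : nat -> R.
Hypothesis m0 : m 0%N = 1.
Hypothesis m_gt0 : forall n, 0 < m n.
Hypothesis m_rec : forall n, (1 <= n)%N -> (1 + \sum_(1 <= i < n.+1) m i) * m n = 1.

(** As [m n] is the inverse of [lam m n.+1], this is [lam m n = psi (lam m n.+1)], the integer case
    of the functional equation. *)
Lemma lamS n : lam m n.+1 = lam m n + m n.
Proof.
have lamE k : lam m k.+1 = 1 + \sum_(1 <= i < k.+1) m i.
  case: k => [|k] /=; first by rewrite m0 invr1 big_geq// addr0.
  by apply: (mulIf (lt0r_neq0 (m_gt0 k.+1))); rewrite m_rec// mulVf// gt_eqF.
case: n => [|n]; first by rewrite /= m0 invr1 add0r.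
by rewrite !lamE big_nat_recr//= addrA.
Qed.

Lemma lam_sum n : lam m n = \sum_(i < n) m i.
Proof. by elim: n => [|n IH]; rewrite ?big_ord0// big_ord_recr/= -IH -lamS. Qed.

Lemma lam_gt0 n : 0 < lam m n.+1. Proof. by rewrite /= invr_gt0. Qed.

Lemma lam_ge0 n : 0 <= lam m n. Proof. by case: n => // n; exact/ltW/lam_gt0. Qed.

Lemma lam_ge1 n : 1 <= lam m n.+1.
Proof.
elim: n => [|n IH]; first by rewrite /= m0 invr1.
by rewrite lamS; have := m_gt0 n.+1; lra.
Qed.

Lemma lam_m n : lam m n.+1 * m n = 1.
Proof. by rewrite /= mulVf// gt_eqF. Qed.

Lemma lam_sqr n : lam m n.+1 ^+ 2 = lam m n ^+ 2 + 2 - m n ^+ 2.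
Proof.
have h := lam_m n; have e := lamS n.
have -> : lam m n = lam m n.+1 - m n by rewrite e; ring.
have -> : (lam m n.+1 - m n) ^+ 2 = lam m n.+1 ^+ 2 - 2 * (lam m n.+1 * m n) + m n ^+ 2 by ring.
by rewrite h; ring.
Qed.

(** Origin of [sqrt (2 N)]: squares grow by [2 - m n ^+ 2], and as [m n <= 1] the total defect is at
    most the sum of the [m i], which is [lam m n]. *)
Lemma lam_bounds n : 2 * n%:R - lam m n <= lam m n ^+ 2 <= 2 * n%:R.
Proof.
elim: n => [|n IH]; first by rewrite /= mulr0 subr0 expr0n/= lexx.
have m1 : 0 < m n <= 1.
  by have := lam_ge1 n; have := lam_m n; have := m_gt0 n; nra.
by rewrite lam_sqr -natr1; have := lamS n; move: IH; nra.
Qed.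

Lemma lam_ge_sqrt n : n%:R <= lam m n ^+ 2.
Proof.
elim: n => [|n IH]; first by rewrite expr0n.
have m1 : 0 < m n <= 1.
  by have := lam_ge1 n; have := lam_m n; have := m_gt0 n; nra.
by rewrite lam_sqr -natr1; nra.
Qed.

(** This is [1 / m n.+1 = 1 / m n + m n.+1] cleared of denominators. Only products of moments
    remain, so linear combinations over [n] can be read as integrals. *)
Lemma m_relation n : m n - m n.+1 = m n.+1 ^+ 2 * m n.
Proof.
have h := lam_m n; have h' := lam_m n.+1; rewrite (lamS n.+1) in h'.
have e : (lam m n.+1 + m n.+1) * m n.+1 * m n = m n by rewrite h' mul1r.
have : m n.+1 * (lam m n.+1 * m n) + m n.+1 ^+ 2 * m n = m n by rewrite -[RHS]e; ring.
by rewrite h; lra.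
Qed.

Lemma m_small (e : R) : 0 < e -> exists n, m n <= e.
Proof.
move=> e0; exists (Num.bound (e ^- 2)).
set n := Num.bound _.
have nB : e ^- 2 <= n%:R by apply/ltW/archi_boundP; rewrite invr_ge0 exprn_ge0// ltW.
have h := lam_ge_sqrt n.+1.
have l0 := lam_gt0 n.
have h2 : e^-1 <= lam m n.+1.
  have e1 : 0 <= e^-1 by rewrite invr_ge0 ltW.
  rewrite -ler_sqr ?nnegrE//; last exact: ltW.
  by rewrite exprVn (le_trans nB)// (le_trans _ h)// ler_nat.
by rewrite -[m n]invrK -/(lam m n.+1) -(invrK e) lef_pV2 ?posrE ?invr_gt0.
Qed.

End Sequence.

(** * Integrals of bounded functions over the unit interval *)

Section UnitIntegral.
Variable R : realType.
Variable mu : probability R R.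
Implicit Types (g h : R -> R).

Definition unit_int g := Rintegral mu `[0, 1] g.

Definition bounded_measurable g := measurable_fun (`[0, 1] : set R) g /\
  exists M, forall t, 0 <= t <= 1 -> `|g t| <= M.

Lemma bounded_measurable_integrable g (A : set R) : measurable A -> A `<=` `[0, 1] -> bounded_measurable g ->
  mu.-integrable A (EFin \o g).
Proof.
move=> mA A01 [mg [M gM]]; apply: measurable_bounded_integrable => //.
- by rewrite (le_lt_trans (probability_le1 mu mA))// ltry.
- exact: measurable_funS A01 mg.
- exists M; split; first exact: num_real.
  move=> K MK t /A01; rewrite /= in_itv/= => /gM h; exact: le_trans h (ltW MK).
Qed.

Lemma bounded_measurable_unit_integrable g : bounded_measurable g -> mu.-integrable `[0, 1] (EFin \o g).
Proof. by move=> gn; apply: bounded_measurable_integrable. Qed.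

Lemma bounded_measurable_cst c : bounded_measurable (fun=> c).
Proof. by split; [exact: measurable_cst|exists `|c|]. Qed.

Lemma bounded_measurableD g h : bounded_measurable g -> bounded_measurable h -> bounded_measurable (fun t => g t + h t).
Proof.
move=> [mg [M gM]] [mh [N hN]]; split; first exact: measurable_funD.
exists (M + N) => t t01; apply: le_trans (ler_normD _ _) _; apply: lerD; [exact: gM|exact: hN].
Qed.

Lemma bounded_measurableM g h : bounded_measurable g -> bounded_measurable h -> bounded_measurable (fun t => g t * h t).
Proof.
move=> [mg [M gM]] [mh [N hN]]; split; first exact: measurable_funM.
exists (M * N) => t t01; rewrite normrM; apply: ler_pM => //; [exact: gM|exact: hN].
Qed.

Lemma bounded_measurableB g h : bounded_measurable g -> bounded_measurable h -> bounded_measurable (fun t => g t - h t).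
Proof.
move=> gn hn; have := bounded_measurableD gn (bounded_measurableM (bounded_measurable_cst (- 1)) hn).
by under eq_fun do rewrite mulN1r.
Qed.

Lemma bounded_measurable_exp n : bounded_measurable (fun t => t ^+ n).
Proof.
split; first exact: exprn_measurable.
by exists 1 => t /andP[t0 t1]; rewrite ger0_norm ?exprn_ge0// exprn_ile1.
Qed.

Lemma powR_le1 (t x : R) : 0 <= t <= 1 -> 0 <= x -> t `^ x <= 1.
Proof.
move=> /andP[t0 t1] x0; have [->|tn] := eqVneq t 0.
  by rewrite /powR eqxx lern1; case: eqP.
rewrite -(powRr0 t); apply: ger_powR => //.
by rewrite t1 andbT lt_neqAle eq_sym tn.
Qed.

Lemma bounded_measurable_powR x : 0 <= x -> bounded_measurable (fun t => t `^ x).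
Proof.
move=> x0; split; first by apply: measurable_funTS; exact: measurable_powR.
by exists 1 => t t01; rewrite ger0_norm ?powR_ge0// powR_le1.
Qed.

Lemma bounded_measurable_sum (I : Type) (r : seq I) (a : I -> R) (g : I -> R -> R) :
  (forall i, bounded_measurable (g i)) -> bounded_measurable (fun t => \sum_(i <- r) a i * g i t).
Proof.
move=> gn; elim: r => [|i r IH].
  by under eq_fun do rewrite big_nil; exact: bounded_measurable_cst.
under eq_fun do rewrite big_cons.
by apply: bounded_measurableD => //; apply: bounded_measurableM => //; exact: bounded_measurable_cst.
Qed.

Lemma unit_intD g h : bounded_measurable g -> bounded_measurable h ->
  unit_int (fun t => g t + h t) = unit_int g + unit_int h.
Proof. by move=> gn hn; apply: RintegralD => //; exact: bounded_measurable_unit_integrable. Qed.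

Lemma unit_intB g h : bounded_measurable g -> bounded_measurable h ->
  unit_int (fun t => g t - h t) = unit_int g - unit_int h.
Proof. by move=> gn hn; apply: RintegralB => //; exact: bounded_measurable_unit_integrable. Qed.

Lemma unit_intZ c g : bounded_measurable g -> unit_int (fun t => c * g t) = c * unit_int g.
Proof. by move=> gn; apply: RintegralZl => //; exact: bounded_measurable_unit_integrable. Qed.

Lemma unit_int_sum (I : Type) (r : seq I) (a : I -> R) (g : I -> R -> R) :
  (forall i, bounded_measurable (g i)) ->
  unit_int (fun t => \sum_(i <- r) a i * g i t) = \sum_(i <- r) a i * unit_int (g i).
Proof.
move=> gn; elim: r => [|i r IH].
  under [in LHS]eq_fun do rewrite big_nil.
  by rewrite big_nil /unit_int Rintegral_cst// mul0r.
under [in LHS]eq_fun do rewrite big_cons.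
rewrite big_cons unit_intD ?IH ?unit_intZ//; last exact: bounded_measurable_sum.
by apply: bounded_measurableM => //; exact: bounded_measurable_cst.
Qed.

Hypothesis mu1 : mu [set 1] = 0%E.

Lemma unit_intE g : bounded_measurable g -> unit_int g = Rintegral mu `[0, 1[ g.
Proof.
move=> gn; rewrite /unit_int.
have e : `[0, 1]%classic = `[0, 1[%classic `|` [set (1 : R)].
  by rewrite setUitv1// bnd_simp.
rewrite e Rintegral_setU//=.
- rewrite [X in _ + X](_ : _ = 0) ?addr0// /Rintegral null_set_integral//.
  apply/measurable_EFinP; case: gn => mg _; apply: measurable_funS mg => //.
  by move=> _ -> /=; rewrite in_itv/= ler01 lexx.
- by rewrite -e; exact: bounded_measurable_unit_integrable.
- by apply/disj_setPS => t [/=]; rewrite in_itv/= => /andP[_ t1] e1; rewrite e1 ltxx in t1.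
Qed.

Lemma eq_unit_int g h : bounded_measurable g -> bounded_measurable h -> (forall t, 0 <= t < 1 -> g t = h t) ->
  unit_int g = unit_int h.
Proof.
move=> gn hn gh; rewrite !unit_intE//; apply: eq_Rintegral => t.
by rewrite inE/= in_itv/=; exact: gh.
Qed.

Lemma le_unit_int g h : bounded_measurable g -> bounded_measurable h -> (forall t, 0 <= t < 1 -> g t <= h t) ->
  unit_int g <= unit_int h.
Proof.
move=> gn hn gh; rewrite !unit_intE//.
have sub : `[(0 : R), 1[ `<=` `[0, 1] by apply: subset_itvl; rewrite bnd_simp.
by apply: le_Rintegral => //; try exact: bounded_measurable_integrable.
Qed.

Lemma unit_int_le g M : bounded_measurable g -> (forall t, 0 <= t < 1 -> `|g t| <= M) ->
  `|unit_int g| <= M.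
Proof.
move=> gn gM.
have M0 : 0 <= M by apply: le_trans (gM 0 _) => //; rewrite lexx ltr01.
have c1 : unit_int (fun=> M) <= M.
  rewrite /unit_int Rintegral_cst// ler_piMr//.
  have p1 := probability_le1 mu (measurable_itv `[(0 : R), 1]).
  by rewrite -lee_fin fineK// ge0_fin_numE// (le_lt_trans p1)// ltry.
have h1 : unit_int g <= unit_int (fun=> M).
  apply: le_unit_int => //; first exact: bounded_measurable_cst.
  by move=> t /gM; rewrite ler_norml => /andP[].
have h2 : unit_int (fun=> - M) <= unit_int g.
  apply: le_unit_int => //; first exact: bounded_measurable_cst.
  by move=> t /gM; rewrite ler_norml => /andP[].
have c2 : unit_int (fun=> - M) = - unit_int (fun=> M) by rewrite /unit_int !Rintegral_cst// mulNr.
by rewrite ler_norml; apply/andP; split; lra.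
Qed.

End UnitIntegral.

(** * Moments of real order *)

Section Moments.
Variable R : realType.
Variable m : nat -> R.
Variable mu : probability R R.
Hypothesis m0 : m 0%N = 1.
Hypothesis m_gt0 : forall n, 0 < m n.
Hypothesis m_rec : forall n, (1 <= n)%N -> (1 + \sum_(1 <= i < n.+1) m i) * m n = 1.
Hypothesis mom : forall n, Rintegral mu `[0, 1] (fun t => t ^+ n) = m n.

(* At [t = 1] the quotient is [0] instead of its limit [x]; this is harmless
   because [mu] has no atom at [1], see [mu_one]. *)
Definition bern_kernel (x t : R) := (1 - t `^ x) / (1 - t).
Definition bernF x := Rintegral mu `[0, 1] (bern_kernel x).
Definition momG x := Rintegral mu `[0, 1] (fun t => t `^ x).

(** An atom at [1] would add its full mass to every moment, and the moments become arbitrarily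
    small. *)
Lemma mu_one : mu [set 1] = 0%E.
Proof.
have m1 : measurable [set (1 : R)] by [].
have fin1 : mu [set 1] \is a fin_num.
  by rewrite ge0_fin_numE// (le_lt_trans (probability_le1 mu m1))// ltry.
rewrite -(fineK fin1); congr EFin; apply/eqP; rewrite eq_le fine_ge0// andbT.
apply/ler_addgt0Pr => e e0; rewrite add0r.
have [n mn] := m_small m0 m_gt0 m_rec e0; apply: le_trans mn; rewrite -mom.
have eI : `[0, 1]%classic = `[0, 1[%classic `|` [set (1 : R)] by rewrite setUitv1// bnd_simp.
rewrite eI Rintegral_setU//=; last 2 first.
- by rewrite -eI; apply: bounded_measurable_unit_integrable; exact: bounded_measurable_exp.
- by apply/disj_setPS => t [/=]; rewrite in_itv/= => /andP[_ t1] e1; rewrite e1 ltxx in t1.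
rewrite [X in _ <= _ + X](_ : _ = fine (mu [set 1])); last first.
  rewrite (@eq_Rintegral _ _ _ mu _ (fun=> 1)); first by rewrite Rintegral_cst// mul1r.
  by move=> t; rewrite inE /= => ->; rewrite expr1n.
by rewrite lerDr; apply: Rintegral_ge0 => t /=; rewrite in_itv/= => /andP[t0 _]; rewrite exprn_ge0.
Qed.

Lemma bern_kernel_exp n t : 0 <= t < 1 -> bern_kernel n%:R t = \sum_(i < n) t ^+ i.
Proof.
move=> /andP[t0 t1]; rewrite /bern_kernel powR_mulrn//.
have h : 1 - t != 0 by rewrite subr_eq0 gt_eqF.
apply: (mulIf h); rewrite divfK// -{1}(expr1n _ n) subrXX mulrC; congr (_ * _).
by apply: eq_bigr => i _; rewrite expr1n mul1r.
Qed.

Lemma powR_anti (t x y : R) : 0 <= t <= 1 -> 0 < x -> x <= y -> t `^ y <= t `^ x.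
Proof.
move=> /andP[t0 t1] x0 xy; have [->|tn] := eqVneq t 0.
  by rewrite !powR0// gt_eqF//; lra.
by apply: ger_powR => //; rewrite t1 andbT lt_neqAle eq_sym tn.
Qed.

(** For [t < 1] the kernel grows with [x], so an integer exponent above [x] bounds it by a geometric
    sum. *)
Lemma bounded_measurable_kernel x : 0 < x -> bounded_measurable (bern_kernel x).
Proof.
move=> x0; split.
  have mp : measurable_fun `[(0 : R), 1] (fun t => (1 - t `^ x) * (1 - t) `^ (-1)).
    apply: measurable_funM.
      by apply: measurable_funB; [exact: measurable_cst|apply: measurable_funTS; exact: measurable_powR].
    apply: measurable_funTS; apply: (measurableT_comp (measurable_powR (-1))).
    by apply: measurable_funB; [exact: measurable_cst|exact: measurable_id].
  apply: eq_measurable_fun mp => t; rewrite inE/= in_itv/= => /andP[t0 t1].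
  by rewrite powR_inv1 ?subr_ge0.
exists (Num.bound x)%:R => t t01; have [t0 t1] := andP t01.
have xn : x <= (Num.bound x)%:R by apply/ltW/archi_boundP/ltW.
have [->|tn] := eqVneq t 1; first by rewrite /bern_kernel subrr invr0 mulr0 normr0.
have t1' : t < 1 by rewrite lt_neqAle tn.
have k0 : 0 <= bern_kernel x t.
  by rewrite divr_ge0// subr_ge0// powR_le1// ltW.
rewrite ger0_norm//; apply: (@le_trans _ _ (bern_kernel (Num.bound x)%:R t)).
  by rewrite ler_wpM2r ?invr_ge0 ?subr_ge0// lerD2l lerN2; apply: powR_anti.
rewrite bern_kernel_exp ?t0//.
have -> : (Num.bound x)%:R = \sum_(i < Num.bound x) 1 :> R by rewrite sumr_const card_ord.
by apply: ler_sum => i _; rewrite exprn_ile1.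
Qed.

Lemma bernF_nat n : (0 < n)%N -> bernF n%:R = lam m n.
Proof.
move=> n0; rewrite lam_sum//.
transitivity (unit_int mu (fun t => \sum_(i <- index_enum 'I_n) 1 * t ^+ i)).
  apply: eq_unit_int; first exact: mu_one.
  - by apply: bounded_measurable_kernel; rewrite ltr0n.
  - by apply: (@bounded_measurable_sum R _ _ (fun=> 1) (fun (i : 'I_n) (t : R) => t ^+ i)) => i; exact: bounded_measurable_exp.
  - by move=> t /bern_kernel_exp ->; apply: eq_bigr => i _; rewrite mul1r.
rewrite (@unit_int_sum R mu _ _ (fun=> 1) (fun (i : 'I_n) (t : R) => t ^+ i)); last by move=> i; exact: bounded_measurable_exp.
by apply: eq_bigr => i _; rewrite mul1r -mom.
Qed.

Lemma bernF_le x y : 0 < x -> x <= y -> bernF x <= bernF y.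
Proof.
move=> x0 xy; apply: le_unit_int; first exact: mu_one.
- exact: bounded_measurable_kernel.
- by apply: bounded_measurable_kernel; lra.
- move=> t /andP[t0 t1]; rewrite ler_wpM2r ?invr_ge0 ?subr_ge0 ?(ltW t1)//.
  by rewrite lerD2l lerN2 powR_anti// t0 ltW.
Qed.

Lemma bernF_ge0 x : 0 < x -> 0 <= bernF x.
Proof.
move=> x0; apply: Rintegral_ge0 => t /=; rewrite in_itv/= => t01.
by rewrite divr_ge0// subr_ge0; [apply: powR_le1 => //; exact: ltW|case/andP: t01].
Qed.

Lemma bernF_diff x : 0 < x -> bernF (x + 1) - bernF x = momG x.
Proof.
move=> x0; have x1 : 0 < x + 1 by lra.
rewrite /bernF -/(unit_int mu _) -/(unit_int mu _) -unit_intB; try exact: bounded_measurable_kernel.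
apply: eq_unit_int; first exact: mu_one.
- by apply: bounded_measurableB; exact: bounded_measurable_kernel.
- exact/bounded_measurable_powR/ltW.
- move=> t /andP[t0 t1]; rewrite /bern_kernel.
  have -> : t `^ (x + 1) = t `^ x * t.
    by rewrite powRD ?powRr1// gt_eqF.
  by field; rewrite subr_eq0 gt_eqF.
Qed.

(** The kernel increment is [t ^ z] times a nonnegative weight independent of [z], and [t ^ z]
    decreases in [z]. This concavity later gives the monotonicity of the derivative without
    differentiating under the integral. *)
Lemma bernF_increments x y h : 0 < x -> x <= y -> 0 <= h ->
  0 <= bernF (y + h) - bernF y <= bernF (x + h) - bernF x.
Proof.
move=> x0 xy h0; have [p1 p2 p3] : [/\ 0 < y, 0 < y + h & 0 < x + h] by split; lra.
rewrite /bernF -/(unit_int mu _) -/(unit_int mu _) -/(unit_int mu _) -/(unit_int mu _).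
rewrite -!unit_intB; try exact: bounded_measurable_kernel.
have kE z t : 0 < z -> 0 <= t -> t < 1 ->
    bern_kernel (z + h) t - bern_kernel z t = t `^ z * ((1 - t `^ h) / (1 - t)).
  move=> z0 t0 t1; rewrite /bern_kernel.
  have -> : t `^ (z + h) = t `^ z * t `^ h.
    by rewrite powRD// gt_eqF//; lra.
  by field; rewrite subr_eq0 gt_eqF.
have k0 t : 0 <= t -> t < 1 -> 0 <= (1 - t `^ h) / (1 - t).
  by move=> t0 t1; rewrite divr_ge0// subr_ge0 ?(ltW t1)// powR_le1// t0 ltW.
apply/andP; split.
  rewrite -(_ : unit_int mu (fun=> 0) = 0); last by rewrite /unit_int Rintegral_cst// mul0r.
  apply: le_unit_int; [exact: mu_one|exact: bounded_measurable_cst|by apply: bounded_measurableB; exact: bounded_measurable_kernel|].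
  by move=> t /andP[t0 t1]; rewrite kE// mulr_ge0 ?powR_ge0 ?k0.
apply: le_unit_int; [exact: mu_one|by apply: bounded_measurableB; exact: bounded_measurable_kernel..|].
move=> t /andP[t0 t1]; rewrite !kE// ler_wpM2r ?k0// powR_anti// t0 ltW//.
Qed.


Lemma momG_nat n : momG n%:R = m n.
Proof.
rewrite -mom; apply: eq_unit_int; first exact: mu_one.
- exact: bounded_measurable_powR.
- exact: bounded_measurable_exp.
- by move=> t /andP[t0 _]; rewrite powR_mulrn.
Qed.

Lemma momG_anti x y : 0 < x -> x <= y -> momG y <= momG x.
Proof.
move=> x0 xy; apply: le_unit_int; first exact: mu_one.
- by apply: bounded_measurable_powR; lra.
- exact/bounded_measurable_powR/ltW.
- by move=> t /andP[t0 t1]; rewrite powR_anti// t0 ltW//.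
Qed.

Lemma momG_gt0 x : 0 < x -> 0 < momG x.
Proof.
move=> x0; apply: lt_le_trans (m_gt0 (Num.bound x)) _; rewrite -momG_nat.
by apply: momG_anti => //; exact/ltW/archi_boundP/ltW.
Qed.

(* Replacing [s] by [s t], multiplying by [t ^+ j] and integrating in [t]. *)
Lemma moment_approx N (c : nat -> R) (a y e : R) j : 0 < y ->
  (forall s, 0 <= s <= 1 -> `|\sum_(k < N) c k * s ^+ k - a * s `^ y| <= e) ->
  forall s, 0 <= s <= 1 ->
  `|\sum_(k < N) c k * m (k + j) * s ^+ k - a * momG (y + j%:R) * s `^ y| <= e.
Proof.
move=> y0 H s /andP[s0 s1].
pose g t := \sum_(k <- index_enum 'I_N) (c k * s ^+ k) * t ^+ (k + j)
            - (a * s `^ y) * t `^ (y + j%:R).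
have yj : 0 <= y + j%:R by rewrite addr_ge0 ?ler0n// ltW.
have gn1 : bounded_measurable (fun t => \sum_(k <- index_enum 'I_N) (c k * s ^+ k) * t ^+ (k + j)).
  by apply: (@bounded_measurable_sum R _ _ (fun k : 'I_N => c k * s ^+ k) (fun (k : 'I_N) (t : R) => t ^+ (k + j))) => k; exact: bounded_measurable_exp.
have gn2 : bounded_measurable (fun t => (a * s `^ y) * t `^ (y + j%:R)).
  by apply: bounded_measurableM; [exact: bounded_measurable_cst|exact: bounded_measurable_powR].
have -> : \sum_(k < N) c k * m (k + j) * s ^+ k - a * momG (y + j%:R) * s `^ y = unit_int mu g.
  rewrite unit_intB// (@unit_int_sum R mu _ _ (fun k : 'I_N => c k * s ^+ k) (fun (k : 'I_N) (t : R) => t ^+ (k + j))); last by move=> k; exact: bounded_measurable_exp.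
  rewrite unit_intZ; last exact: bounded_measurable_powR.
  rewrite [unit_int mu _]/(momG _) mulrAC; congr (_ - _).
  by apply: eq_bigr => k _; rewrite /unit_int mom mulrAC.
apply: unit_int_le; [exact: mu_one|exact: bounded_measurableB|].
move=> t /andP[t0 t1].
have -> : g t = t ^+ j * (\sum_(k < N) c k * (s * t) ^+ k - a * (s * t) `^ y).
  rewrite /g mulrBr mulr_sumr; congr (_ - _).
    by apply: eq_bigr => k _; rewrite exprMn exprD; ring.
  rewrite powRM// powRD ?powR_mulrn//; first by ring.
  by rewrite gt_eqF//; have := ler0n R j; lra.
rewrite normrM ger0_norm ?exprn_ge0//.
have st : 0 <= s * t <= 1 by apply/andP; split; nra.
have h := H _ st; apply: le_trans h; rewrite ler_piMl// exprn_ile1//; exact: ltW.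
Qed.

#[local] Opaque bernF momG.

(* For integers [y] this is [m_relation]; both sides are integrals of [u `^ y],
   over [mu] and over the product of three copies of [mu]. *)
Lemma momG_relation y : 1 <= y -> momG y - momG (y + 1) = momG (y + 1) ^+ 2 * momG y.
Proof.
move=> y1; have y0 : 0 < y by lra.
have [L L0 hL] := powR_lipschitz y1.
apply/eqP; rewrite -subr_eq0 -normr_le0; apply/ler_addgt0Pr => e e0; rewrite add0r.
have e3 : 0 < e / 3 by rewrite divr_gt0.
have [p hp] := lipschitz_poly_approx L0 e3 hL.
have H s : 0 <= s <= 1 -> `|\sum_(k < size p) p`_k * s ^+ k - 1 * s `^ y| <= e / 3.
  by move=> /hp; rewrite horner_coef mul1r.
have one : 0 <= (1 : R) <= 1 by rewrite ler01 lexx.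
(* Each use multiplies the coefficients by one more moment: at [s = 1], [ha] approximates [G y],
   [hb] approximates [G (y+1)], and [hd], through [hc], approximates [G (y+1) G y G (y+1)]. *)
have ha := moment_approx 0 y0 H; have hb := moment_approx 1 y0 H.
have hc := @moment_approx _ (fun k => p`_k * m (k + 1)) _ _ _ 0 y0 hb.
have hd := @moment_approx _ (fun k => p`_k * m (k + 1) * m (k + 0)) _ _ _ 1 y0 hc.
move: (ha 1 one) (hb 1 one) (hd 1 one); rewrite !powR1 !mulr1 !mul1r !addr0.
set A := \sum_(k < _) _; set B := \sum_(k < _) _; set D := \sum_(k < _) _.
have : A - B - D = 0.
  rewrite /A /B /D -!sumrB; apply: big1 => k _; rewrite !expr1n !mulr1.
  have := m_relation m0 m_gt0 m_rec k; rewrite !addn0 !addn1 => e1.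
  have -> : p`_k * m k - p`_k * m k.+1 - p`_k * m k.+1 * m k * m k.+1
    = p`_k * ((m k - m k.+1) - m k.+1 ^+ 2 * m k) by ring.
  by rewrite e1 subrr mulr0.
clearbody A B D; move: (momG y) (momG (y + 1) ^+ 2 * momG y) (momG (y + 1)) => G0 G2 G1.
rewrite !ler_norml => ABD /andP[? ?] /andP[? ?] /andP[? ?]; apply/andP; split; lra.
Qed.

Lemma m_anti i j : (i <= j)%N -> m j <= m i.
Proof.
move=> /subnK <-; elim: (j - i)%N => [|k IH]//; rewrite addSn; apply: le_trans IH.
have := m_relation m0 m_gt0 m_rec (k + i); have := m_gt0 (k + i).
have := sqr_ge0 (m (k + i).+1); nra.
Qed.

(* [(G x)^-1 - F (x + 1)] is 1-periodic and tends to [0]: by monotonicity, both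
   terms lie between two consecutive values of [lam m]. *)
Lemma bernF_momG x : 1 <= x -> bernF (x + 1) * momG x = 1.
Proof.
move=> x1; pose d y := (momG y)^-1 - bernF (y + 1).
have dper y : 1 <= y -> d (y + 1) = d y.
  move=> y1; have h := momG_relation y1.
  have y0 : 0 < y by exact: lt_le_trans ltr01 y1.
  have y10 : 0 < y + 1 by exact: addr_gt0.
  have g0 := momG_gt0 y0; have g1 := momG_gt0 y10.
  rewrite /d.
  have -> : bernF (y + 1 + 1) = bernF (y + 1) + momG (y + 1).
    by rewrite -(bernF_diff y10) addrCA subrr addr0.
  have -> : (momG (y + 1))^-1 = (momG y)^-1 + momG (y + 1); last by ring.
  apply: (mulIf (lt0r_neq0 (mulr_gt0 g0 g1))).
  transitivity (momG y); first by field; rewrite gt_eqF.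
  transitivity (momG (y + 1) + momG (y + 1) ^+ 2 * momG y); first by rewrite -h addrC subrK.
  by field; rewrite gt_eqF.
have dpern n : d (x + n%:R) = d x.
  elim: n => [|n IH]; first by rewrite addr0.
  have xn : 1 <= x + n%:R by rewrite (le_trans x1)// lerDl ler0n.
  by rewrite -natr1 addrA (dper _ xn).
have dx : d x = 0.
  apply/eqP; rewrite -normr_le0; apply/ler_addgt0Pr => e e0; rewrite add0r.
  have [n mn] := m_small m0 m_gt0 m_rec e0.
  rewrite -(dpern n.+1); set z := x + n.+1%:R.
  have z0 : 0 <= z by rewrite addr_ge0//; lra.
  have := truncn_itv z0; set k := Num.truncn z => /andP[kz zk].
  have kn : (n < k)%N.
    by rewrite -ltnS -(ltr_nat R) (le_lt_trans _ zk)// /z; lra.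
  have k0 : 0 < k%:R :> R by rewrite ltr0n; case: (k) kn.
  have zp : 0 < z by apply: lt_le_trans kz.
  apply: le_trans mn; apply: le_trans (m_anti (leqW (ltnW kn))).
  have g1 : momG k.+1%:R <= momG z by apply: momG_anti => //; exact: ltW.
  have g2 : momG z <= momG k%:R by exact: momG_anti.
  have f1 : bernF k.+1%:R <= bernF (z + 1).
    by apply: bernF_le; rewrite ?ltr0n// -natr1 lerD2r.
  have f2 : bernF (z + 1) <= bernF k.+2%:R.
    by apply: bernF_le; [exact: addr_gt0|rewrite -[k.+2%:R]natr1 lerD2r ltW].
  rewrite !momG_nat in g1 g2; rewrite !bernF_nat// in f1 f2.
  have gz := momG_gt0 zp.
  have i1 : lam m k.+1 <= (momG z)^-1 by rewrite /= lef_pV2 ?posrE.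
  have i2 : (momG z)^-1 <= lam m k.+2 by rewrite /= lef_pV2 ?posrE.
  have := lamS m0 m_gt0 m_rec k.+1.
  by rewrite ler_norml /d => e1; apply/andP; split; lra.
have gx : momG x != 0 by rewrite gt_eqF// momG_gt0//; lra.
by move/eqP: dx; rewrite subr_eq0 => /eqP <-; rewrite mulVf.
Qed.

End Moments.

(** * Iterated preimages of zero under psi *)

Section Iteration.
Variable R : realType.
Implicit Types (s z x : R).

(** The two inverse branches of [psi]: the roots of [z ^ 2 - s z - 1], whose product is [-1]. *)
Definition psi_neg s : R := (s - Num.sqrt (s ^+ 2 + 4)) / 2.
Definition psi_pos s : R := (s + Num.sqrt (s ^+ 2 + 4)) / 2.

Lemma sqrt_disc s : [/\ 0 < Num.sqrt (s ^+ 2 + 4), s < Num.sqrt (s ^+ 2 + 4),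
  - s < Num.sqrt (s ^+ 2 + 4) & Num.sqrt (s ^+ 2 + 4) ^+ 2 = s ^+ 2 + 4].
Proof.
have p : 0 < s ^+ 2 + 4 by have := sqr_ge0 s; lra.
have r0 : 0 < Num.sqrt (s ^+ 2 + 4) by rewrite sqrtr_gt0.
have e : Num.sqrt (s ^+ 2 + 4) ^+ 2 = s ^+ 2 + 4 by rewrite sqr_sqrtr// ltW.
by split => //; nra.
Qed.

Lemma psi_neg_lt0 s : psi_neg s < 0.
Proof. by rewrite /psi_neg; have [] := sqrt_disc s; lra. Qed.

Lemma psi_pos_gt0 s : 0 < psi_pos s.
Proof. by rewrite /psi_pos; have [] := sqrt_disc s; lra. Qed.

Lemma psi_mono_pos x z : 0 < x -> x < z -> psi x < psi z.
Proof.
move=> x0 xz; rewrite /psi; have : z^-1 < x^-1 by rewrite ltf_pV2 ?posrE//; lra.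
lra.
Qed.

Lemma psi_mono_neg x z : x < z -> z < 0 -> psi x < psi z.
Proof.
move=> xz z0; rewrite /psi; have : z^-1 < x^-1 by rewrite ltf_nV2 ?negrE//; lra.
lra.
Qed.

Lemma psi_negK s : psi (psi_neg s) = s.
Proof.
have h := psi_neg_lt0 s; have [_ _ _ e] := sqrt_disc s; rewrite /psi.
apply: (mulIf (ltr0_neq0 h)); rewrite mulrBl mulVf ?ltr0_neq0//.
by move: e; rewrite /psi_neg; set r := Num.sqrt _ => e; lra.
Qed.

Lemma psi_posK s : psi (psi_pos s) = s.
Proof.
have h := psi_pos_gt0 s; have [_ _ _ e] := sqrt_disc s; rewrite /psi.
apply: (mulIf (lt0r_neq0 h)); rewrite mulrBl mulVf ?lt0r_neq0//.
by move: e; rewrite /psi_pos; set r := Num.sqrt _ => e; lra.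
Qed.

Lemma psi_posE x s : 0 < x -> psi x = s -> x = psi_pos s.
Proof.
move=> x0 xs; have := psi_posK s; rewrite -{2}xs => e.
case: (ltgtP x (psi_pos s)) => // h.
  by have := psi_mono_pos x0 h; rewrite e ltxx.
by have := psi_mono_pos (psi_pos_gt0 s) h; rewrite e ltxx.
Qed.

Lemma psi_negE x s : x < 0 -> psi x = s -> x = psi_neg s.
Proof.
move=> x0 xs; have := psi_negK s; rewrite -{2}xs => e.
case: (ltgtP x (psi_neg s)) => // h.
  by have := psi_mono_neg h (psi_neg_lt0 s); rewrite e ltxx.
by have := psi_mono_neg h x0; rewrite e ltxx.
Qed.

Lemma psi_neg_mono x z : x < z -> psi_neg x < psi_neg z.
Proof.
move=> xz; rewrite ltNge; apply/negP; rewrite le_eqVlt => /orP[/eqP h|h].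
  by move: xz; rewrite -(psi_negK x) -(psi_negK z) h ltxx.
have := psi_mono_neg h (psi_neg_lt0 x); rewrite !psi_negK; lra.
Qed.

Lemma psi_pos_mono x z : x < z -> psi_pos x < psi_pos z.
Proof.
move=> xz; rewrite ltNge; apply/negP; rewrite le_eqVlt => /orP[/eqP h|h].
  by move: xz; rewrite -(psi_posK x) -(psi_posK z) h ltxx.
have := psi_mono_pos (psi_pos_gt0 z) h; rewrite !psi_posK; lra.
Qed.

Lemma lamsS s n : lams s n.+1 = psi_pos (lams s n). Proof. by []. Qed.

(** Both branches increase and the negative one lies below the positive one, so the list comes out
    sorted. *)
Fixpoint Yseq n : seq R :=
  if n is n'.+1 then map psi_neg (Yseq n') ++ map psi_pos (Yseq n') else [:: 0].

Lemma size_Yseq n : size (Yseq n) = (2 ^ n)%N.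
Proof. by elim: n => // n IH; rewrite /= size_cat !size_map IH addnn -mul2n expnS. Qed.

Lemma mem_Yseq n z : z \in Yseq n <-> Yset n z.
Proof.
elim: n z => [|n IH] z.
  by rewrite /= inE; split=> [/eqP->//|[_ /= ->]].
have YS : Yset n.+1 z <-> z != 0 /\ Yset n (psi z).
  split=> [[h1 h2]|[z0 [h1 h2]]].
    split; first by have := h1 0%N isT.
    by split=> [j jn|]; rewrite -iterSr//; exact: h1.
  by split=> [[//|j] jn|]; rewrite iterSr//; exact: h1.
rewrite YS -IH /= mem_cat; split.
  move=> /orP[] /mapP[y yn ->].
    by rewrite psi_negK ltr0_neq0// psi_neg_lt0.
  by rewrite psi_posK lt0r_neq0// psi_pos_gt0.
move=> [z0 zn]; case: (ltgtP z 0) z0 => // h _; apply/orP; [left|right].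
  by apply/mapP; exists (psi z) => //; exact: psi_negE.
by apply/mapP; exists (psi z) => //; exact: psi_posE.
Qed.

Lemma sorted_map_in (g : R -> R) (r : seq R) :
  {in r &, forall x z, x < z -> g x < g z} -> sorted <%R r -> sorted <%R (map g r).
Proof.
move=> gm; rewrite sorted_map; apply: (sub_in_sorted (P := mem r)); last exact/allP.
by move=> x z xr zr; apply: gm.
Qed.

Lemma sorted_Yseq n : sorted <%R (Yseq n).
Proof.
elim: n => // n IH /=; rewrite (sorted_pairwise lt_trans) pairwise_cat.
rewrite -!(sorted_pairwise lt_trans) !sorted_map_in//; last 2 first.
- by move=> x z _ _; exact: psi_pos_mono.
- by move=> x z _ _; exact: psi_neg_mono.
rewrite !andbT; apply/allrelP => x z /mapP[x' _ ->] /mapP[z' _ ->].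
exact: lt_trans (psi_neg_lt0 _) (psi_pos_gt0 _).
Qed.

Lemma kth_sorted (A : set R) (r : seq R) i : sorted <%R r ->
  (forall x, x \in r <-> A x) -> (i < size r)%N -> xget 0 (kth A i.+1) = nth 0 r i.
Proof.
move=> sr rA ir; have ur := lt_sorted_uniq sr.
have below j y : (j < size r)%N -> y \in take j r <-> (A y /\ y < nth 0 r j).
  move=> jr; split=> [yt|[/rA yr]].
    have yr := mem_take yt; split; first exact/rA.
    rewrite -{1}(nth_index 0 yr) (lt_sorted_ltn_nth 0 sr) ?inE ?index_mem//.
    by rewrite -in_take.
  rewrite -{1}(nth_index 0 yr) (lt_sorted_ltn_nth 0 sr) ?inE ?index_mem//.
  by rewrite -in_take.
apply: xget_unique => [|x [/rA xr [t [ut st tA]]]].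
  split; first by apply/rA; exact: mem_nth.
  exists (take i r); split; [exact: take_uniq|by rewrite size_take ir|].
  by move=> y; exact: below.
have xi : (index x r < size r)%N by rewrite index_mem.
have /perm_size : perm_eq t (take (index x r) r).
  apply: uniq_perm => //; first exact: take_uniq.
  have nx := nth_index 0 xr.
  by move=> y; apply/idP/idP => [/tA h|/(below _ _ xi) h]; [apply/(below _ _ xi)|apply/tA];
    move: h; rewrite nx.
by rewrite size_take xi st /= => ->; rewrite nth_index.
Qed.

Lemma alphaE n k : (k < 2 ^ n)%N -> alpha R n k.+1 = nth 0 (Yseq n) k.
Proof.
move=> kn; apply: kth_sorted; [exact: sorted_Yseq|exact: mem_Yseq|by rewrite size_Yseq].
Qed.

(** Source of [r(k, l)]: in each half of the sorted list of level [n.+1], [psi] preserves the rank,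
    so it acts on ranks as reduction modulo [2 ^ n]. *)
Lemma psi_alpha n k : (k < 2 ^ n.+1)%N -> psi (alpha R n.+1 k.+1) = alpha R n (rr k.+1 n).
Proof.
move=> kn; rewrite /rr !alphaE ?ltn_mod ?expn_gt0// /= nth_cat !size_map size_Yseq.
have [kl|kl] := ltnP k (2 ^ n).
  by rewrite (nth_map 0) ?size_Yseq// psi_negK modn_small.
have kk : (k - 2 ^ n < 2 ^ n)%N.
  by move: kn; rewrite expnS mul2n -addnn ltn_subLR.
rewrite (nth_map 0) ?size_Yseq// psi_posK.
by rewrite -{2}(subnK kl) modnDr modn_small.
Qed.

Lemma iter_psi_alpha l j k : (k < 2 ^ (l + j))%N ->
  iter j (@psi R) (alpha R (l + j) k.+1) = alpha R l (rr k.+1 l).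
Proof.
elim: j k => [|j IH] k; first by rewrite addn0 /rr/= => /modn_small->.
rewrite addnS => kn; rewrite iterSr psi_alpha// /rr IH /=.
  by rewrite /rr/= modn_dvdm// dvdn_exp2l// leq_addr.
by rewrite ltn_mod expn_gt0.
Qed.

(** The ranks up to [2 ^ n] are the negative half of level [n.+1]: the values that [f] can take on
    []-1, 0[]. *)
Lemma alpha_neg n k : (k < 2 ^ n)%N -> alpha R n.+1 k.+1 = psi_neg (nth 0 (Yseq n) k).
Proof.
move=> kn; rewrite alphaE; last by rewrite expnS mul2n -addnn ltn_addr.
by rewrite /= nth_cat size_map size_Yseq kn (nth_map 0) ?size_Yseq.
Qed.

Lemma mem_neg_Yseq n z : z \in map psi_neg (Yseq n) <-> z < 0 /\ Yset n.+1 z.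
Proof.
rewrite -mem_Yseq /= mem_cat; split.
  by move=> zn; rewrite zn; split => //; case/mapP: zn => y _ ->; exact: psi_neg_lt0.
move=> [z0 /orP[//|/mapP[y _ e]]].
by move: z0; rewrite e ltNge ltW// psi_pos_gt0.
Qed.

End Iteration.

(** * Derivatives in Caratheodory's form *)

Section HasDerivative.
Variable K : numFieldType.
Implicit Types (g : K -> K) (z w l : K).

Definition has_derivative g z l := exists q : K -> K,
  [/\ cont_pt q z, near_pt z (fun w => g w = g z + q w * (w - z)) & q z = l].

Lemma has_derivative_cdiff g z l : has_derivative g z l -> cdiff g z.
Proof. by move=> [q [qc qE _]]; exists q. Qed.

(** The increment in direction [1] ranges over all of [K], so over [R[i]] this is complex
    differentiability. *)
Lemma derivable_has_derivative g z : derivable (g : K^o -> K^o) z 1 ->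
  has_derivative g z (derive1 (g : K^o -> K^o) z).
Proof.
move=> dg; have := dg => /cvg_ex[l gl].
have lE : derive1 (g : K^o -> K^o) z = l.
  rewrite derive1E; apply: cvg_lim => //; exact: norm_hausdorff.
rewrite lE; move: gl => /cvgrPdist_le gl.
pose q w : K := if w == z then (l : K) else (g w - g z) / (w - z).
exists q; split; last by rewrite /q eqxx.
  move=> e e0; have := gl e e0; rewrite near_withinE.
  move=> /nbhs_ballP[d d0 hd]; exists d => // w; rewrite /q eqxx distrC => zw.
  case: eqP => [_|/eqP wz]; first by rewrite subrr normr0 ltW.
  have := hd (w - z); rewrite /ball/= sub0r normrN distrC => /(_ zw).
  rewrite subr_eq0 => /(_ wz).
  by rewrite /shift/= [_ *: 1]mulr1 subrK [_ *: (_ - _)]mulrC distrC.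
exists 1 => // w _; rewrite /q; case: eqP => [->|/eqP wz]; first by rewrite subrr mulr0 addr0.
by rewrite divfK ?subr_eq0// addrC subrK.
Qed.

Lemma has_derivative_is_derive g z l : has_derivative g z l ->
  is_derive (z : K^o) 1 (g : K^o -> K^o) l.
Proof.
move=> [q [qc qE ql]].
have cl : (fun h : K^o => h^-1 *: (((g : K^o -> K^o) \o shift (z : K^o)) (h *: 1) - g z) : K^o) @ 0^' --> (l : K^o).
  apply/cvgrPdist_le => e e0; rewrite near_withinE.
  have [d d0 hd] := near_ptI (qc e e0) qE.
  apply/nbhs_ballP; exists d => // h; rewrite /ball/= sub0r normrN => hd' h0.
  have [] := hd (h + z); rewrite addrK => // h1 h2.
  by rewrite [h *: 1]mulr1 /shift h2 [g z + _]addrC addrK [_ *: _]mulrC mulfK// -ql distrC.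
apply: DeriveDef; first by apply/cvg_ex; exists l.
by apply: cvg_lim => //; exact: norm_hausdorff.
Qed.

Lemma has_derivative_unique g z l l' : has_derivative g z l -> has_derivative g z l' -> l = l'.
Proof.
move=> /has_derivative_is_derive dl /has_derivative_is_derive dl'.
by have := @derive_val _ _ _ _ _ _ _ dl; rewrite (@derive_val _ _ _ _ _ _ _ dl').
Qed.

End HasDerivative.

(** * The functional equation on the real line *)

Section Meromorphic.
Variable R : realType.
Variable m : nat -> R.
Variable mu : probability R R.
Local Open Scope complex_scope.
Variables (f : R[i]^o -> R[i]^o) (P : set R[i]^o).
Local Notation Re := complex.Re.
Local Notation Im := complex.Im.
Hypothesis m0 : m 0%N = 1.
Hypothesis m_gt0 : forall n, 0 < m n.
Hypothesis m_rec : forall n, (1 <= n)%N -> (1 + \sum_(1 <= i < n.+1) m i) * m n = 1.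
Hypothesis mom : forall n, Rintegral mu `[0, 1] (fun t => t ^+ n) = m n.
Hypothesis P_discrete : forall z, exists2 e : R, 0 < e &
  forall w, P w -> w != z -> e%:C <= `|w - z|.
Hypothesis f_derivable : forall z, ~ P z -> derivable f z 1.
Hypothesis f_pole : forall a, P a -> forall M : R, \forall z \near dnbhs a, M%:C < `|f z|.
Hypothesis f_pos : forall x : R, 0 < x -> f x%:C = (bernF mu x)%:C.

Let F := bernF mu.

#[local] Opaque bernF momG.

Lemma f_has_derivative z : ~ P z -> has_derivative (f : R[i] -> R[i]) z (derive1 f z).
Proof. by move=> /f_derivable; exact: derivable_has_derivative. Qed.

Lemma realC_norm (x : R) : `|x%:C : R[i]| = `|x|%:C.
Proof. by rewrite normc_def /= expr0n addr0 sqrtr_sqr. Qed.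

(** At a pole [f] is large on a full punctured neighbourhood, so a bound on the right side of the
    real line excludes it. *)
Lemma not_pole_near (x : R) (M e : R) : 0 < e ->
  (forall h : R, 0 < h < e -> `|f (x + h)%:C| <= M%:C) -> ~ P x%:C.
Proof.
move=> e0 fM /f_pole/(_ M); rewrite near_withinE => /nbhs_ballP[d d0 hd].
have [r r0 dE] := posc d0.
pose h := Num.min r e / 2.
have [h0 hr he] : [/\ 0 < h, h < r & h < e].
  have k0 : 0 < Num.min r e by rewrite lt_min r0.
  have k1 : Num.min r e <= r by rewrite ge_min lexx.
  have k2 : Num.min r e <= e by rewrite ge_min lexx orbT.
  by rewrite /h; split; lra.
have := hd (x + h)%:C; rewrite /ball/= dE.
have -> : `|(x%:C : R[i]) - (x + h)%:C| = h%:C.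
  by rewrite -rmorphB/= realC_norm opprD addNKr normrN gtr0_norm.
rewrite ltcR => /(_ hr); have -> : ((x + h)%:C : R[i]) != x%:C.
  by rewrite eq_complex /= eqxx andbT -subr_eq0 addrC addKr gt_eqF.
move=> /(_ isT) lt; have := fM h; rewrite h0 he => /(_ isT) /(lt_le_trans lt).
by rewrite ltxx.
Qed.

Lemma not_pole_ge0 (x : R) : 0 <= x -> ~ P x%:C.
Proof.
move=> x0; apply: (@not_pole_near x (F (x + 1)) 1 ltr01) => h /andP[h0 h1].
have xh : 0 < x + h by lra.
rewrite f_pos// realC_norm lecR ger0_norm; first by apply: (bernF_le m0 m_gt0 m_rec mom); lra.
by apply: bernF_ge0.
Qed.

(* This is [f z f (z+1) - f (z+1)^2 + 1], in a shape to which [cdiff_affine],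
   [cdiffM] and [cdiffD] apply literally. *)
Definition feq_defect (z : R[i]) : R[i] := f z * f (1 + 1 * z) + (- 1 * (f (1 + 1 * z) * f (1 + 1 * z)) + 1).
Definition feq_poles : set R[i] := [set z | P z \/ P (1 + 1 * z)].

Lemma feq_poles_finite : locally_finite feq_poles.
Proof.
move=> z; have [e1 e10 h1] := P_discrete z; have [e2 e20 h2] := P_discrete (1 + 1 * z).
exists (Num.min e1 e2); first by rewrite lt_min e10.
move=> w [Pw|Pw] wz.
  by apply: le_trans (h1 _ Pw wz); rewrite lecR ge_min lexx.
have wz1 : 1 + 1 * w != 1 + 1 * z by rewrite !mul1r (inj_eq (addrI _)).
have := h2 _ Pw wz1; rewrite !mul1r opprD addrACA subrr add0r.
by apply: le_trans; rewrite lecR ge_min lexx orbT.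
Qed.

Lemma feq_real (x : R) : ~ P x%:C -> ~ P (x + 1)%:C ->
  f x%:C * f (x + 1)%:C = f (x + 1)%:C ^+ 2 - 1.
Proof.
move=> Px Px1.
have sh (y : R) : 1 + 1 * (y%:C : R[i]) = (y + 1)%:C by rewrite mul1r addrC -(rmorph1 (real_complex R)) -rmorphD.
(* The threshold [1] is that of [bernF_momG], inherited from the Lipschitz bound on powers. *)
have := @identity_real_line R feq_defect feq_poles 1 feq_poles_finite.
move=> H; have {H} : feq_defect x%:C = 0.
  apply: H; last by rewrite /feq_poles /= sh => -[].
    move=> z /not_orP[nP nP1].
    have d0 := has_derivative_cdiff (f_has_derivative nP).
    have d1 := @cdiff_affine _ (f : R[i] -> R[i]) 1 1 z (has_derivative_cdiff (f_has_derivative nP1)).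
    apply: cdiffD; first exact: cdiffM.
    by apply: cdiffD; [apply: cdiffM; [exact: cdiff_cst|exact: cdiffM]|exact: cdiff_cst].
  move=> y y1; rewrite /feq_defect sh !f_pos; [|lra|lra].
  have e1 : bernF mu (y + 1) * momG mu y = 1 by apply: (bernF_momG m0 m_gt0 m_rec mom); lra.
  have e2 : bernF mu (y + 1) - bernF mu y = momG mu y by apply: (bernF_diff m0 m_gt0 m_rec mom); lra.
  move: e1; rewrite -e2; move: (bernF mu (y + 1)) (bernF mu y) => a b e1.
  apply/eqP; rewrite eq_complex /=; apply/andP; split; apply/eqP; last by ring.
  by lra.
rewrite /feq_defect sh => /eqP; rewrite addr_eq0 => /eqP ->; ring.
Qed.


Lemma norm_realE (z : R[i]) : exists2 r : R, 0 <= r & `|z| = r%:C.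
Proof. by rewrite normc_def; eexists; last reflexivity; exact: sqrtr_ge0. Qed.

Lemma pick_small (a b c d : R) : 0 < a -> 0 < b -> 0 < c -> 0 < d ->
  exists2 e : R, 0 < e & [/\ e <= a, e <= b, e <= c & e <= d].
Proof.
move=> a0 b0 c0 d0; exists (Num.min (Num.min a b) (Num.min c d)).
  by rewrite !lt_min a0 b0 c0 d0.
by split; rewrite !ge_min lexx ?orbT.
Qed.

Lemma not_pole_punctured (x : R) : exists2 e : R, 0 < e &
  forall y : R, y != x -> `|y - x| < e -> ~ P y%:C.
Proof.
have [e e0 he] := P_discrete x%:C; exists e => // y yx lt Py.
have yx' : (y%:C : R[i]) != x%:C by rewrite (inj_eq (@complexI R)).
have := he _ Py yx'; rewrite -rmorphB/= realC_norm lecR; lra.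
Qed.

Lemma f_cont (x : R) : ~ P x%:C -> forall e : R, 0 < e -> exists2 d : R, 0 < d &
  forall y : R, `|y - x| < d -> `|f y%:C - f x%:C| <= e%:C.
Proof.
move=> Px e e0; have e0' : 0 < e%:C :> R[i] by rewrite ltcR.
have [_ /posc[d d0 ->] hd] := cdiff_cont (has_derivative_cdiff (f_has_derivative Px)) e0'.
by exists d => // y yd; apply: hd; rewrite -rmorphB/= realC_norm ltcR.
Qed.

(* If [x + 1] were a pole, [f w = f (w+1) - 1 / f (w+1)] would be unbounded near [x]. *)
Lemma pole_shift (x : R) : ~ P x%:C -> ~ P (x + 1)%:C.
Proof.
move=> Px Px1; have [B B0 fB] := norm_realE (f x%:C).
have [d1 d10 h1] := f_cont Px ltr01.
have [d2 d20 h2] := not_pole_punctured x; have [d3 d30 h3] := not_pole_punctured (x + 1).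
have := f_pole Px1 (B + 2); rewrite near_withinE => /nbhs_ballP[d /posc[d4 d40 ->] h4].
have [e e0 [le1 le2 le3 le4]] := pick_small d10 d20 d30 d40.
pose w := x + e / 2.
have we : `|w - x| < e by rewrite /w addrC addKr gtr0_norm; lra.
have we1 : `|w + 1 - (x + 1)| < e by rewrite opprD addrACA subrr addr0.
have wx : w != x by rewrite gt_eqF// /w; lra.
have wx1 : w + 1 != x + 1 by rewrite (inj_eq (addIr _)).
have fw := feq_real (h2 w wx (lt_le_trans we le2)) (h3 _ wx1 (lt_le_trans we1 le3)).
have := h4 (w + 1)%:C; rewrite /ball/= -rmorphB/= realC_norm distrC ltcR.
rewrite (inj_eq (@complexI R)) => /(_ (lt_le_trans we1 le4) wx1).
have [A A0 fA] := norm_realE (f (w + 1)%:C); rewrite fA ltcR => BA.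
have := h1 w (lt_le_trans we le1).
have [C C0 fC] := norm_realE (f w%:C) => fwx.
have CB : C <= B + 1.
  rewrite -lecR rmorphD/= -fC -fB -[f w%:C](subrK (f x%:C)) [leRHS]addrC.
  by apply: le_trans (ler_normD _ _) _; rewrite lerD2r.
have : A ^+ 2 <= C * A + 1.
  rewrite -lecR rmorphD rmorphXn rmorphM /= -fA -fC -normrM -normrX.
  rewrite -[f (w + 1)%:C ^+ 2](subrK 1) -fw; apply: le_trans (ler_normD _ _) _.
  by rewrite normr1.
nra.
Qed.

Lemma f_next_neq0 (x : R) : ~ P x%:C -> f (x + 1)%:C != 0.
Proof.
move=> Px; have := feq_real Px (pole_shift Px); apply: contraPneq => ->.
by rewrite mulr0 expr0n/= sub0r => /esym/eqP; rewrite oppr_eq0 oner_eq0.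
Qed.

Lemma f_prev (x : R) : ~ P x%:C -> f x%:C = f (x + 1)%:C - (f (x + 1)%:C)^-1.
Proof.
move=> Px; have n0 := f_next_neq0 Px; apply: (mulIf n0).
by rewrite (feq_real Px (pole_shift Px)) mulrBl mulVf// expr2.
Qed.

(** Near [x + 1] the modulus of [f] stays between [A / 2] and [3 A / 2], so [f (w+1) - 1 / f (w+1)]
    is bounded. *)
Lemma pole_shift_back (x : R) : ~ P (x + 1)%:C -> f (x + 1)%:C != 0 -> ~ P x%:C.
Proof.
move=> Px1 fx1; have [A A0 fA] := norm_realE (f (x + 1)%:C).
have Ap : 0 < A by rewrite -ltcR -fA normr_gt0.
have A2 : 0 < A / 2 by lra.
have [d1 d10 h1] := f_cont Px1 A2.
have [d2 d20 h2] := not_pole_punctured x; have [d3 d30 h3] := not_pole_punctured (x + 1).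
have [e e0 [le1 le2 le3 _]] := pick_small d10 d20 d30 d30.
apply: (@not_pole_near x (3 / 2 * A + 2 / A) e e0) => h /andP[h0 he].
have we : `|x + h - x| < e by rewrite addrC addKr gtr0_norm; lra.
have we1 : `|x + h + 1 - (x + 1)| < e by rewrite opprD addrACA subrr addr0.
have wx : x + h != x by rewrite gt_eqF//; lra.
have wx1 : x + h + 1 != x + 1 by rewrite (inj_eq (addIr _)).
have fw := feq_real (h2 _ wx (lt_le_trans we le2)) (h3 _ wx1 (lt_le_trans we1 le3)).
have := h1 _ (lt_le_trans we1 le1).
set a := f (x + h + 1)%:C in fw * => fa.
have [a' a'0 na] := norm_realE a.
have [C C0 fC] := norm_realE (f (x + h)%:C).
have a1 : a' <= 3 / 2 * A.
  rewrite (_ : 3 / 2 * A = A / 2 + A); last by field.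
  rewrite -lecR rmorphD/= -na -fA -[a](subrK (f (x + 1)%:C)).
  by apply: le_trans (ler_normD _ _) _; rewrite lerD2r.
have a2 : A / 2 <= a'.
  have : A <= A / 2 + a'; last by lra.
  rewrite -lecR rmorphD/= -na -fA -[f (x + 1)%:C](subrK a).
  by apply: le_trans (ler_normD _ _) _; rewrite lerD2r distrC.
have : C * a' <= a' ^+ 2 + 1.
  rewrite -lecR rmorphD rmorphXn rmorphM /= -na -fC -normrM fw.
  by apply: le_trans (ler_normB _ _) _; rewrite normrX normr1.
move=> Ca; rewrite fC lecR.
have ap : 0 < a' by lra.
have ia : a'^-1 <= 2 / A.
  by rewrite -[2 / A]invrK invf_div lef_pV2 ?posrE.
have : C <= a' + a'^-1; last by lra.
by rewrite -(ler_pM2r ap) mulrDl mulVf ?gt_eqF.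
Qed.

Definition line_val (x : R) : R := Re (f x%:C).
Definition line_der (x : R) : R := Re (derive1 f x%:C).

Lemma line_val_pos (x : R) : 0 < x -> line_val x = F x.
Proof. by move=> x0; rewrite /line_val f_pos. Qed.

Lemma f_real (x : R) : ~ P x%:C -> f x%:C = (line_val x)%:C.
Proof.
have [n] : exists n : nat, 0 < x + n%:R.
  exists (Num.bound `|x|); have := archi_boundP (normr_ge0 x).
  by have := ler_norm (- x); rewrite normrN; lra.
elim: n x => [|n IH] x; first by rewrite addr0 => x0 _; rewrite line_val_pos// f_pos.
move=> xn Px; have h : f (x + 1)%:C = (line_val (x + 1))%:C.
  by apply: IH; [move: xn; rewrite -natr1; lra|exact: pole_shift].
by rewrite /line_val f_prev// h -fmorphV -rmorphB.
Qed.

Lemma line_val_next_neq0 (x : R) : ~ P x%:C -> line_val (x + 1) != 0.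
Proof.
by move=> Px; have := f_next_neq0 Px; rewrite (f_real (pole_shift Px)) eq_complex /= eqxx andbT.
Qed.

Lemma line_val_psi (x : R) : ~ P x%:C -> line_val x = psi (line_val (x + 1)).
Proof.
move=> Px; have n0 := line_val_next_neq0 Px; rewrite {1}/line_val f_prev// (f_real (pole_shift Px)) /psi.
by rewrite -fmorphV -rmorphB.
Qed.

Lemma line_val_derivative (x : R) : ~ P x%:C ->
  derive1 f x%:C = (line_der x)%:C /\ has_derivative line_val x (line_der x).
Proof.
move=> Px; have [q [qc [_ /posc[d d0 ->] qE] ql]] := f_has_derivative Px.
have gq (y : R) : `|y - x| < d -> f y%:C = f x%:C + q y%:C * (y - x)%:C.
  by move=> yx; rewrite rmorphB; apply: qE; rewrite -rmorphB/= realC_norm ltcR.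
have qr (e : R) : 0 < e -> exists2 r : R, 0 < r & forall y : R, `|y - x| < r ->
    `|Re (q y%:C) - line_der x| <= e /\ `|Im (q y%:C) - Im (derive1 f x%:C)| <= e.
  move=> e0; have e0' : 0 < e%:C :> R[i] by rewrite ltcR.
  have [_ /posc[r r0 ->] hr] := qc _ e0'; exists r => // y yr.
  have := hr y%:C; rewrite -rmorphB/= realC_norm ltcR => /(_ yr) /Re_Im_le.
  by rewrite ql /line_der; case: (q _) => ? ?; case: (derive1 _ _) => ? ?.
split.
  (* At real [y <> x] the slope [q y] is real since [f] is; continuity passes this on to [q x]. *)
  suff : Im (derive1 f x%:C) = 0 by rewrite /line_der; case: (derive1 _ _) => a b /= ->.
  apply/eqP; rewrite -normr_le0; apply/ler_addgt0Pr => e e0; rewrite add0r.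
  have [r r0 hr] := qr e e0; have [s s0 hs] := not_pole_punctured x.
  have [t t0 [t1 t2 t3 _]] := pick_small r0 s0 d0 d0.
  pose y := x + t / 2.
  have yt : `|y - x| < t by rewrite /y addrC addKr gtr0_norm; lra.
  have yx : y != x by rewrite gt_eqF// /y; lra.
  have [_] := hr y (lt_le_trans yt t1).
  have := gq y (lt_le_trans yt t3).
  rewrite (f_real (hs y yx (lt_le_trans yt t2))) (f_real Px).
  case: (q _) => a b [_]; rewrite mulr0 !add0r => /esym/eqP.
  by rewrite mulf_eq0 subr_eq0 (negPf yx) orbF => /eqP /= ->; rewrite sub0r normrN.
exists (fun y => Re (q y%:C)); split; last by rewrite ql.
- move=> e e0; have [r r0 hr] := qr e e0; exists r => // y /hr[].
  by rewrite ql.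
- exists d => // y yd; rewrite /line_val gq// (f_real Px); case: (q _) => a b /=.
  by rewrite mulr0 subr0.
Qed.

Lemma line_der_step (x : R) : ~ P x%:C -> line_der x = (1 + (line_val (x + 1) ^+ 2)^-1) * line_der (x + 1).
Proof.
move=> Px; have [_ d0] := line_val_derivative Px; have [_ d1] := line_val_derivative (pole_shift Px).
apply: has_derivative_unique d0 _.
have c1 := cdiff_cont (has_derivative_cdiff d1).
case: d1 => q [qc qE ql]; set a := line_val (x + 1) in c1 *.
have a0 : a != 0 := line_val_next_neq0 Px.
have sh (k : R -> R) : cont_pt k (x + 1) -> cont_pt (fun y => k (1 + 1 * y)) x.
  rewrite addrC -{1}(mul1r x) => kc e e0.
  exact: (@cont_near_affine _ (fun w => `|k w - k (1 + 1 * x)| <= e) 1 1 x (kc e e0)).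
(* The slope of [psi] between [a] and [b] is [1 + 1 / (a b)]. *)
exists (fun y => q (1 + 1 * y) * (1 + (a * line_val (1 + 1 * y))^-1)); split.
- apply: contM; first exact: sh.
  apply: contD; first exact: cont_cst.
  apply: contV; first by rewrite mul1r addrC mulf_neq0.
  by apply: contM; [exact: cont_cst|exact: sh].
- have [e e0 he] := not_pole_punctured x.
  have nP : near_pt x (fun y => ~ P y%:C).
    by exists e => // y ye; have [->//|yx] := eqVneq y x; exact: he.
  rewrite addrC -{1}(mul1r x) in qE.
  apply: near_ptS (near_ptI nP (cont_near_affine qE)) => y [Py]; rewrite !mul1r.
  rewrite (line_val_psi Py) (line_val_psi Px) -/a [y + 1]addrC => E.
  have b0 : line_val (1 + y) != 0 by rewrite addrC; exact: line_val_next_neq0.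
  have a1 : line_val (1 + x) = a by rewrite addrC.
  rewrite a1 in E; move: E b0; set b := line_val (1 + y) => E b0; rewrite /psi.
  have e1 : 1 + y - (1 + x) = y - x by ring.
  rewrite e1 in E; have e2 : q (1 + y) * (y - x) = b - a by rewrite E; ring.
  rewrite mulrAC e2; field; by rewrite a0 b0.
- by rewrite mul1r [1 + x]addrC ql mulrC.
Qed.

End Meromorphic.

(** * Zeros and limits *)

Section RealSide.
Variable R : realType.
Variable m : nat -> R.
Hypothesis m0 : m 0%N = 1.
Hypothesis m_gt0 : forall n, 0 < m n.
Hypothesis m_rec : forall n, (1 <= n)%N -> (1 + \sum_(1 <= i < n.+1) m i) * m n = 1.
(** The regular points of the real line, [f] on them and its derivative: what follows is real
    analysis. *)
Variables (D : R -> Prop) (g dg : R -> R).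
Hypothesis D_next : forall x, D x -> D (x + 1).
Hypothesis g_next_neq0 : forall x, D x -> g (x + 1) != 0.
Hypothesis g_psi : forall x, D x -> g x = psi (g (x + 1)).
Hypothesis D_prev : forall x, D (x + 1) -> g (x + 1) != 0 -> D x.
Hypothesis g_der : forall x, D x -> has_derivative g x (dg x).
Hypothesis dg_step : forall x, D x -> dg x = (1 + (g (x + 1) ^+ 2)^-1) * dg (x + 1).
Hypothesis D_ge0 : forall x, 0 <= x -> D x.
Hypothesis g_nat : forall n, (0 < n)%N -> g n%:R = lam m n.
Hypothesis g_ge0 : forall x, 0 < x -> 0 <= g x.
Hypothesis g_incr : forall x y h, 0 < x -> x <= y -> 0 <= h ->
  0 <= g (y + h) - g y <= g (x + h) - g x.

Lemma g_step x : D x -> g (x + 1) = g x + (g (x + 1))^-1.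
Proof. by move=> Dx; rewrite (g_psi Dx) /psi subrK. Qed.

Lemma g_at0 : g 0 = 0.
Proof. by rewrite (g_psi (D_ge0 (lexx 0))) add0r (g_nat (n := 1))//= m0 invr1 /psi invr1 subrr. Qed.

Lemma g_next_gt0 x : 0 <= x -> 0 < g (x + 1).
Proof.
by move=> x0; rewrite lt_neqAle eq_sym (g_next_neq0 (D_ge0 x0)) g_ge0//; lra.
Qed.

Lemma g_le x y : 0 < x -> x <= y -> g x <= g y.
Proof.
move=> x0 xy; have := @g_incr x x (y - x) x0 (lexx _); rewrite addrCA subrr addr0.
by rewrite subr_ge0 xy => /(_ isT) /andP[]; rewrite subr_ge0.
Qed.

Lemma dg_anti x y : 0 < x -> x <= y -> dg y <= dg x.
Proof.
move=> x0 xy; rewrite leNgt; apply/negP => lt.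
have [qx [cx [d1 d10 E1] qxx]] := g_der (D_ge0 (ltW x0)).
have [qy [cy [d2 d20 E2] qyy]] := g_der (D_ge0 (ltW (lt_le_trans x0 xy))).
have e0 : 0 < (dg y - dg x) / 4 by lra.
have [d3 d30 C1] := cx _ e0; have [d4 d40 C2] := cy _ e0.
have [h h0 [h1 h2 h3 h4]] : exists2 e : R, 0 < e & [/\ e < d1, e < d2, e < d3 & e < d4].
  exists (Num.min (Num.min d1 d2) (Num.min d3 d4) / 2).
    by rewrite divr_gt0// !lt_min d10 d20 d30.
  have mn : 0 < Num.min (Num.min d1 d2) (Num.min d3 d4) by rewrite !lt_min d10 d20 d30.
  set k := Num.min _ _ in mn *.
  have [k1 k2 k3 k4] : [/\ k <= d1, k <= d2, k <= d3 & k <= d4].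
    by split; rewrite !ge_min lexx ?orbT.
  by split; lra.
have hn (z : R) : `|z + h - z| = h by rewrite addrC addKr gtr0_norm.
have hz (z : R) : z + h - z = h by rewrite addrC addKr.
have := E1 (x + h); rewrite hn hz => /(_ h1) gx.
have := E2 (y + h); rewrite hn hz => /(_ h2) gy.
have := C1 (x + h); rewrite hn qxx => /(_ h3); rewrite ler_norml => /andP[_ ux].
have := C2 (y + h); rewrite hn qyy => /(_ h4); rewrite ler_norml => /andP[uy _].
have /andP[_] := g_incr x0 xy (ltW h0); rewrite gx gy addrAC subrr add0r addrAC subrr add0r.
by rewrite ler_pM2r// => uu; lra.
Qed.

Lemma g_continuous a b : 0 <= a -> {within `[a, b], continuous g}.
Proof.
move=> a0; apply: continuous_in_subspaceT => x; rewrite inE/= in_itv/= => /andP[ax _].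
by apply/cont_ptP; apply: (cdiff_cont (has_derivative_cdiff (g_der (D_ge0 _)))); lra.
Qed.

Lemma g_mvt a b : 0 <= a -> a < b ->
  exists2 c, a < c < b & g b - g a = dg c * (b - a).
Proof.
move=> a0 ab; have [||c] := @MVT R g dg a b ab.
- move=> x; rewrite in_itv/= => /andP[ax _].
  by apply: has_derivative_is_derive; apply: g_der; apply: D_ge0; lra.
- exact: g_continuous.
- by rewrite in_itv/= => hc e; exists c.
Qed.

(** The increment of [g] over [[x, x + 1]] is exactly [1 / g (x + 1)], a value of the decreasing
    [dg] inside that interval; [dg_upper] uses [[x - 1, x]]. *)
Lemma dg_lower x : 0 < x -> (g (x + 1))^-1 <= dg x.
Proof.
move=> x0; have x1 : x < x + 1 by lra.
have [c /andP[xc _] E] := g_mvt (ltW x0) x1; have e := g_step (D_ge0 (ltW x0)).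
have -> : (g (x + 1))^-1 = dg c.
  by rewrite (_ : dg c = dg c * (x + 1 - x)); [rewrite -E; lra|ring].
by apply: dg_anti => //; exact: ltW.
Qed.

Lemma dg_upper x : 1 < x -> dg x <= (g x)^-1.
Proof.
move=> x1; have x0 : 0 <= x - 1 by lra.
have xx : x - 1 < x by lra.
have [c /andP[xc cx] E] := g_mvt x0 xx; have := g_step (D_ge0 x0); rewrite subrK => e.
have -> : (g x)^-1 = dg c.
  by rewrite (_ : dg c = dg c * (x - (x - 1))); [rewrite -E; lra|ring].
by apply: dg_anti; [lra|exact: ltW].
Qed.

Lemma dg_gt0 x : 0 < x -> 0 < dg x.
Proof.
by move=> x0; apply: lt_le_trans (dg_lower x0); rewrite invr_gt0 g_next_gt0// ltW.
Qed.

Lemma g_lt x y : 0 <= x -> x < y -> g x < g y.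
Proof.
move=> x0 xy; have [c /andP[xc _] e] := g_mvt x0 xy.
by rewrite -subr_gt0 e mulr_gt0 ?subr_gt0// dg_gt0//; lra.
Qed.

Lemma D_nat x n : D x -> D (x + n%:R).
Proof.
by move=> Dx; elim: n => [|n IH]; rewrite ?addr0// -natr1 addrA; exact: D_next.
Qed.

Lemma g_sum x n : D x -> g (x + n%:R) = g x + \sum_(1 <= l < n.+1) (g (x + l%:R))^-1.
Proof.
move=> Dx; elim: n => [|n IH]; first by rewrite big_geq// !addr0.
by rewrite big_nat_recr//= addrA -IH -natr1 addrA; apply: g_step; exact: D_nat.
Qed.

Lemma dg_prod x n : D x ->
  dg x = \prod_(1 <= l < n.+1) (1 + (g (x + l%:R) ^+ 2)^-1) * dg (x + n%:R).
Proof.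
move=> Dx; elim: n => [|n IH]; first by rewrite big_geq// mul1r addr0.
rewrite big_nat_recr//= -mulrA IH; congr (_ * _).
by rewrite -natr1 addrA; apply: dg_step; exact: D_nat.
Qed.

Let s (N : nat) : R := Num.sqrt (2 * N%:R).

Lemma s_ge0 N : 0 <= s N. Proof. exact: sqrtr_ge0. Qed.

Lemma s_sqr N : s N ^+ 2 = 2 * N%:R.
Proof. by rewrite sqr_sqrtr// mulr_ge0// ler0n. Qed.

(** From [lam_bounds], [(s - lam) (s + lam) <= lam] and [lam <= s]. *)
Lemma lam_near_sqrt N : `|lam m N - s N| <= 1.
Proof.
have /andP[lo hi] := lam_bounds m0 m_gt0 m_rec N.
have l0 := lam_ge0 m_gt0 N; have s0 := s_ge0 N.
move: lo hi; rewrite -s_sqr => lo hi; rewrite ler_norml; apply/andP; split; nra.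
Qed.

Lemma lam_le i j : (i <= j)%N -> lam m i <= lam m j <= lam m i + (j - i)%:R.
Proof.
move=> ij; rewrite -{1 2}(subnK ij); elim: (j - i)%N => [|k IH].
  by rewrite add0n addr0 lexx.
rewrite addSn (lamS m0 m_gt0 m_rec) -natr1.
have : 0 < m (k + i) <= 1.
  rewrite m_gt0; have := lam_m m_gt0 (k + i); have := lam_ge1 m0 m_gt0 m_rec (k + i).
  by have := m_gt0 (k + i); rewrite /=; nra.
by move: IH; lra.
Qed.

Lemma ratio_cvg (b : nat -> R) (K : R) (N0 : nat) : 0 <= K ->
  (forall N, (N0 <= N)%N -> `|b N - s N| <= K) ->
  (fun N => s N / b N) @ \oo --> (1 : R).
Proof.
move=> K0 bK; apply/cvgrPdist_le => e e0.
(* [s N >= T] forces [b N > K / e], which makes the relative error less than [e]. *)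
pose T := K + K / e + 1; pose N1 := Num.bound (T ^+ 2).
exists (maxn N0 N1) => // N /=; rewrite geq_max => /andP[h0 h1].
have T0 : 0 < T by rewrite /T; have := divr_ge0 K0 (ltW e0); lra.
have sT : T <= s N.
  have : T ^+ 2 <= s N ^+ 2.
    rewrite s_sqr; apply: (@le_trans _ _ N%:R); last by have := ler0n R N; lra.
    by apply: le_trans (ltW (archi_boundP (sqr_ge0 _))) _; rewrite ler_nat.
  by rewrite ler_sqr ?nnegrE// ?s_ge0// ltW.
have := bK N h0; rewrite ler_norml => /andP[b1 b2].
have Ke : 0 <= K / e by rewrite divr_ge0// ltW.
have bp : K / e < b N by move: sT; rewrite /T; lra.
have b0 : 0 < b N by lra.
have -> : 1 - s N / b N = (b N - s N) / b N by field; rewrite gt_eqF.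
rewrite normrM normfV (gtr0_norm b0) ler_pdivrMr//.
apply: le_trans (bK N h0) _; move: bp; rewrite ltr_pdivrMr//; nra.
Qed.

Lemma g_near_sqrt (q N : nat) x : (q < N)%N -> N%:R - q%:R <= x <= N%:R + q%:R ->
  `|g x - s N| <= 1 + q%:R.
Proof.
move=> qN /andP[x1 x2].
have qN' := ltnW qN.
have p0 : 0 < (N - q)%:R :> R by rewrite ltr0n subn_gt0.
have h1 : lam m (N - q) <= g x.
  by rewrite -g_nat ?subn_gt0//; apply: g_le => //; rewrite natrB.
have h2 : g x <= lam m (N + q).
  rewrite -g_nat; last by rewrite addn_gt0 (leq_ltn_trans _ qN).
  apply: g_le; last by rewrite natrD.
  by move: p0; rewrite natrB//; lra.
have /andP[_ l1] := lam_le (leq_subr q N); have /andP[_ l2] := lam_le (leq_addr q N).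
rewrite subKn// in l1; rewrite addKn in l2.
have := lam_near_sqrt N; rewrite !ler_norml => /andP[? ?]; apply/andP; split; lra.
Qed.

Lemma dg_inv_near_sqrt (q N : nat) x : (q.+2 < N)%N -> N%:R - q%:R <= x <= N%:R + q%:R ->
  `|(dg x)^-1 - s N| <= 2 + q%:R.
Proof.
move=> qN /andP[x1 x2].
have qNR : q.+2%:R < N%:R :> R by rewrite ltr_nat.
rewrite -!natr1 in qNR; have q0 := ler0n R q.
have x1' : 1 < x by lra.
have xp : 0 < x by lra.
have h1 := dg_lower xp; have h2 := dg_upper x1'.
have dp := dg_gt0 xp; have gx1 := g_next_gt0 (ltW xp).
have gx : 0 < g x by have := @g_next_gt0 (x - 1); rewrite subrK; apply; lra.
have i1 : (dg x)^-1 <= g (x + 1) by rewrite -[g _]invrK lef_pV2 ?posrE ?invr_gt0.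
have i2 : g x <= (dg x)^-1 by rewrite -[g _]invrK lef_pV2 ?posrE ?invr_gt0.
have := @g_near_sqrt q.+1 N x (ltnW qN); have := @g_near_sqrt q.+1 N (x + 1) (ltnW qN).
rewrite -!natr1 => ha hb.
have {}ha := ha (ltac:(apply/andP; split; lra)).
have {}hb := hb (ltac:(apply/andP; split; lra)).
move: ha hb; rewrite !ler_norml => /andP[? ?] /andP[? ?]; apply/andP; split; lra.
Qed.


Lemma g_at1 : g 1 = 1. Proof. by rewrite (g_nat (n := 1))//= m0 invr1. Qed.

Lemma g_gt0 x : 0 < x -> 0 < g x. Proof. by rewrite -{2}g_at0; exact: g_lt. Qed.

Lemma D_unit y : - 1 < y < 0 -> D y.
Proof.
move=> /andP[y1 y0]; apply: D_prev; first by apply: D_ge0; lra.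
by rewrite gt_eqF// g_gt0//; lra.
Qed.

Lemma g_unit y : - 1 < y < 0 -> [/\ 0 < g (y + 1), g (y + 1) < 1 & g y < 0].
Proof.
move=> yy; have /andP[y1 y0] := yy.
have h0 : 0 < g (y + 1) by apply: g_gt0; lra.
have h1 : g (y + 1) < 1 by rewrite -[ltRHS]g_at1; apply: g_lt; lra.
split=> //; rewrite (g_psi (D_unit yy)).
by have := psi_mono_pos h0 h1; rewrite {2}/psi invr1 subrr.
Qed.

Lemma g_unit_lt y z : - 1 < y < 0 -> - 1 < z < 0 -> y < z -> g y < g z.
Proof.
move=> yy zz yz; rewrite (g_psi (D_unit yy)) (g_psi (D_unit zz)).
have [h0 _ _] := g_unit yy; apply: psi_mono_pos => //.
by apply: g_lt; move: yy zz; lra.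
Qed.

Lemma g_unit_surj a : a < 0 -> exists y, - 1 < y < 0 /\ g y = a.
Proof.
move=> a0; have b0 := psi_pos_gt0 a; have pa := psi_posK a.
have b1 : psi_pos a < 1.
  rewrite ltNge le_eqVlt; apply/negP => /orP[/eqP e|h].
    by move: pa; rewrite -e /psi invr1 subrr; lra.
  by have := psi_mono_pos ltr01 h; rewrite pa /psi invr1 subrr; lra.
have [||c] := @IVT R g 0 1 (psi_pos a) ler01.
- exact: g_continuous.
- by rewrite g_at0 g_at1 (min_l ler01) (max_r ler01) (ltW b0) (ltW b1).
rewrite in_itv/= => /andP[c0 c1] gc.
have c0' : 0 < c by rewrite lt_neqAle c0 andbT; apply: contraTneq b0 => c00; rewrite -gc -c00 g_at0 ltxx.
have c1' : c < 1 by rewrite lt_neqAle c1 andbT; apply: contraTneq b1 => c11; rewrite -gc c11 g_at1 ltxx.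
have yy : - 1 < c - 1 < 0 by apply/andP; split; lra.
by exists (c - 1); split=> //; rewrite (g_psi (D_unit yy)) subrK gc.
Qed.

Definition unit_inv a := xget 0 [set y | - 1 < y < 0 /\ g y = a].

Lemma unit_invP a : a < 0 -> - 1 < unit_inv a < 0 /\ g (unit_inv a) = a.
Proof. by move=> /g_unit_surj[y hy]; exact: (@xgetPex _ 0 [set y | - 1 < y < 0 /\ g y = a] (ex_intro _ y hy)). Qed.

Lemma g_unit_inj y z : - 1 < y < 0 -> - 1 < z < 0 -> g y = g z -> y = z.
Proof.
move=> yy zz e; case: (ltgtP y z) => // h.
  by have := g_unit_lt yy zz h; rewrite e ltxx.
by have := g_unit_lt zz yy h; rewrite e ltxx.
Qed.

Lemma unit_inv_lt a b : a < 0 -> b < 0 -> a < b -> unit_inv a < unit_inv b.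
Proof.
move=> /unit_invP[ya ea] /unit_invP[yb eb] ab; rewrite ltNge le_eqVlt.
apply/negP => /orP[/eqP e|h]; first by move: ab; rewrite -ea -eb e ltxx.
by have := g_unit_lt yb ya h; rewrite ea eb; lra.
Qed.

Lemma iter_psi_g x j : D x -> iter j (@psi R) (g (x + j%:R)) = g x.
Proof.
move=> Dx; elim: j => [|j IH]; first by rewrite addr0.
by rewrite iterSr -natr1 addrA -g_psi ?IH//; exact: D_nat.
Qed.

Lemma Yset_g x n : D x -> g x = 0 -> Yset n (g (x + n%:R)).
Proof.
move=> Dx gx; split; last by rewrite iter_psi_g.
move=> j jn; have Dj := D_nat (n - j.+1) Dx.
(* The [j]-th iterate is thus the value of [g] one step after a regular point, hence nonzero. *)
have -> : x + n%:R = x + (n - j.+1)%:R + 1 + j%:R.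
  by rewrite natrB// -natr1; ring.
by rewrite iter_psi_g; [exact: g_next_neq0|exact: D_next].
Qed.

(** Going left, the nonzero iterate at [y - j] is what [D_prev] asks for regularity at
    [y - j - 1]. *)
Lemma g_orbit y n j : D y -> Yset n (g y) -> (j <= n)%N ->
  D (y - j%:R) /\ g (y - j%:R) = iter j (@psi R) (g y).
Proof.
move=> Dy [Y1 _]; elim: j => [|j IH] jn; first by rewrite subr0.
have [Dj gj] := IH (ltnW jn).
have e : y - j.+1%:R + 1 = y - j%:R by rewrite -natr1; ring.
have Dj1 : D (y - j.+1%:R) by apply: D_prev; rewrite e// gj Y1.
by split=> //; rewrite g_psi// e gj.
Qed.

Definition zeros p : set R := [set x | - (p%:R + 1) < x < - p%:R /\ (D x /\ g x = 0)].

Lemma mem_zeros p x :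
  x \in map (fun a => unit_inv a - p.+1%:R) (map (@psi_neg R) (Yseq R p)) <-> zeros p.+1 x.
Proof.
split.
  move=> /mapP[a /mem_neg_Yseq[a0 Ya] ->].
  have [/andP[y1 y0] gy] := unit_invP a0.
  have Dy : D (unit_inv a) by apply: D_unit; rewrite y1.
  rewrite -gy in Ya; have [Dx gx] := g_orbit Dy Ya (leqnn _).
  split; first by apply/andP; split; lra.
  by split=> //; rewrite gx; case: Ya.
move=> [/andP[x1 x2] [Dx gx]]; apply/mapP; exists (g (x + p.+1%:R)).
  have [_ _ h] := @g_unit (x + p.+1%:R) (ltac:(apply/andP; split; lra)).
  by apply/mem_neg_Yseq; split=> //; exact: Yset_g.
have yy : - 1 < x + p.+1%:R < 0 by apply/andP; split; lra.
have [_ _ h] := g_unit yy; have [zz e] := unit_invP h.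
by rewrite (g_unit_inj zz yy e) addrK.
Qed.

(** All maps from [Yseq] to the zeros are increasing, so ranks are preserved. *)
Lemma zeros_kth p k : (k < 2 ^ p)%N ->
  xget 0 (kth (zeros p.+1) k.+1) = unit_inv (alpha R p.+1 k.+1) - p.+1%:R.
Proof.
move=> kp; rewrite (@kth_sorted _ _ (map (fun a => unit_inv a - p.+1%:R) (map (@psi_neg R) (Yseq R p)))).
- by rewrite (nth_map 0) ?size_map ?size_Yseq// (nth_map 0) ?size_Yseq// alpha_neg.
- apply: sorted_map_in; last by apply: sorted_map_in; [move=> ? ? _ _; exact: psi_neg_mono|exact: sorted_Yseq].
  move=> a b /mem_neg_Yseq[a0 _] /mem_neg_Yseq[b0 _] ab.
  by rewrite ltrD2r unit_inv_lt.
- exact: mem_zeros.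
- by rewrite !size_map size_Yseq.
Qed.

(** For [l >= 1] the value [g (y + l)] is positive, which selects the branch [psi_pos] at every
    step. *)
Lemma lams_g y l : D y -> - 1 < y -> lams (g y) l = g (y + l%:R).
Proof.
move=> Dy y1; elim: l => [|l IH]; first by rewrite addr0.
rewrite lamsS IH; apply/esym/psi_posE.
  by apply: g_gt0; rewrite -natr1; have := ler0n R l; lra.
by rewrite -natr1 addrA -g_psi//; exact: D_nat.
Qed.

Lemma cvg_eventually (u v : nat -> R) (l : R) N0 : (forall N, (N0 <= N)%N -> u N = v N) ->
  u @ \oo --> l -> v @ \oo --> l.
Proof.
move=> uv ul; apply: cvg_trans ul; apply: near_eq_cvg.
by exists N0 => // N /= /uv.
Qed.

(** The mean value theorem writes the difference as [dg c * x] with [c] at bounded distance from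
    [N], and [1 / dg c] differs from [sqrt (2 N)] by a bounded amount. *)
Lemma zero_limit x : D x -> x < 0 ->
  (fun N => s N * (g (x + N%:R) - lam m N)) @ \oo --> x.
Proof.
move=> Dx x0; have [q xq] : exists q : nat, - x < q%:R.
  by exists (Num.bound (- x)); apply: archi_boundP; lra.
(* This quotient is [1 / dg c], without a choice of [c] for each [N]. *)
pose b N := x / (g (x + N%:R) - lam m N).
have bE N : (q.+2 < N)%N -> exists2 c, N%:R - q%:R <= c <= N%:R + q%:R &
    [/\ 0 < c, g (x + N%:R) - lam m N = dg c * x & b N = (dg c)^-1].
  move=> qN; have N0 : (0 < N)%N by apply: leq_trans qN.
  have qNR : q.+2%:R < N%:R :> R by rewrite ltr_nat.
  rewrite -!natr1 in qNR; have q0 := ler0n R q.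
  have a0 : 0 <= x + N%:R by lra.
  have aN : x + N%:R < N%:R by lra.
  have [c /andP[c1 c2] e] := g_mvt a0 aN.
  have cp : 0 < c by lra.
  have e' : g (x + N%:R) - lam m N = dg c * x by rewrite -g_nat//; lra.
  exists c; first by apply/andP; split; lra.
  split=> //; rewrite /b e'; field.
  by rewrite gt_eqF ?dg_gt0//= lt_eqF.
have bs : (fun N => s N / b N) @ \oo --> (1 : R).
  apply: (@ratio_cvg b (2 + q%:R) q.+3) => [|N qN]; first by have := ler0n R q; lra.
  by have [c cN [_ _ ->]] := bE N qN; exact: dg_inv_near_sqrt.
have h : (fun N => s N / b N * x) @ \oo --> 1 * x by apply: (cvgM bs); exact: cvg_cst.
rewrite mul1r in h; apply: (@cvg_eventually _ _ _ q.+3 _ h) => N qN /=.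
by have [c _ [c0 -> ->]] := bE N qN; rewrite /= invrK; ring.
Qed.

(** By [dg_prod] the product telescopes to [dg (y + N) / dg y]. *)
Lemma prod_limit y : D y -> - 1 < y ->
  (fun N => s N * \prod_(1 <= l < N.+1) (1 + (g (y + l%:R) ^+ 2)^-1)^-1) @ \oo --> (dg y)^-1.
Proof.
move=> Dy y1; have [q yq] : exists q : nat, `|y| < q%:R.
  by exists (Num.bound `|y|); apply: archi_boundP.
have bs : (fun N => s N / (dg (y + N%:R))^-1) @ \oo --> (1 : R).
  apply: (@ratio_cvg _ (2 + q%:R) q.+3) => [|N qN]; first by have := ler0n R q; lra.
  by apply: dg_inv_near_sqrt => //; move: yq; rewrite ltr_norml => /andP[? ?]; apply/andP; split; lra.
have h : (fun N => s N / (dg (y + N%:R))^-1 * (dg y)^-1) @ \oo --> 1 * (dg y)^-1.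
  by apply: (cvgM bs); exact: cvg_cst.
rewrite mul1r in h; apply: (@cvg_eventually _ _ _ 1%N _ h) => N N1 /=.
have d0 : dg (y + N%:R) != 0.
  by rewrite gt_eqF// dg_gt0//; have : 1%:R <= N%:R :> R by [rewrite ler_nat]; lra.
rewrite invrK prodfV {1}(dg_prod N Dy) invfM -mulrA; congr (_ * _).
by rewrite mulrCA mulfV ?mulr1.
Qed.

Lemma real_zeros p k : (k < 2 ^ p)%N ->
  let x := xget 0 (kth (zeros p.+1) k.+1) in
  [/\ D x,
    (fun N => s N * (\sum_(1 <= l < p.+2) (alpha R l (rr k.+1 l))^-1
      + \sum_(1 <= l < (N - p.+1).+1) (lams (alpha R p.+1 k.+1) l)^-1 - lam m N)) @ \oo --> x &
    exists2 L, (fun N => s N * \prod_(1 <= l < N.+1)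
        (1 + (lams (alpha R p.+1 k.+1) l ^+ 2)^-1)^-1) @ \oo --> L &
      (dg x)^-1 = (\prod_(1 <= l < p.+2) (1 + (alpha R l (rr k.+1 l) ^+ 2)^-1)^-1) * L].
Proof.
move=> kp x; have xE : x = unit_inv (alpha R p.+1 k.+1) - p.+1%:R := zeros_kth kp.
have kp1 : (k < 2 ^ p.+1)%N by apply: leq_trans kp _; rewrite leq_exp2l.
have a0 : alpha R p.+1 k.+1 < 0 by rewrite alpha_neg// psi_neg_lt0.
have Ya : Yset p.+1 (alpha R p.+1 k.+1).
  by apply/mem_Yseq; rewrite alphaE// mem_nth// size_Yseq.
have [yy gy] := unit_invP a0; set y := unit_inv _ in xE yy gy.
have Dy := D_unit yy; have /andP[y1 y0] := yy.
rewrite -gy in Ya; have [Dx gx] := g_orbit Dy Ya (leqnn _); rewrite -xE in Dx gx.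
have gx0 : g x = 0 by rewrite gx; case: Ya.
have gl l : (l <= p.+1)%N -> g (x + l%:R) = alpha R l (rr k.+1 l).
  move=> lp; have [_] := g_orbit Dy Ya (leq_subr l p.+1).
  rewrite (_ : y - _ = x + l%:R); last by rewrite xE natrB//; ring.
  have lk : (k < 2 ^ (l + (p.+1 - l)))%N by rewrite subnKC.
  by move=> ->; rewrite gy -{2}(subnKC lp) iter_psi_alpha.
have xy : x + p.+1%:R = y by rewrite xE subrK.
have x0 : x < 0 by rewrite xE; have := ltr0Sn R p; lra.
split=> //.
  apply: (@cvg_eventually _ _ _ p.+1 _ (zero_limit Dx x0)) => N pN.
  congr (_ * (_ - _)).
  (* The orbit is cut at [y = x + p.+1]: up to there the values of [g] are the [alpha], beyond it
     the [lams]. The truncated subtraction is exact as [p.+1 <= N]. *)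
  have -> : x + N%:R = y + (N - p.+1)%:R by rewrite natrB// xE; ring.
  rewrite g_sum// -xy g_sum// gx0 add0r; congr (_ + _).
    by apply: eq_big_nat => l /andP[_ lp]; rewrite gl.
  by apply: eq_bigr => l _; rewrite xy -gy lams_g.
exists (dg y)^-1.
  apply: (@cvg_eventually _ _ _ 0%N _ (prod_limit Dy y1)) => N _.
  by congr (_ * _); apply: eq_bigr => l _; rewrite -gy lams_g.
rewrite (dg_prod p.+1 Dx) xy invfM -prodfV; congr (_ * _).
by apply: eq_big_nat => l /andP[_ lp]; rewrite gl.
Qed.

Lemma real_zero0 :
  (fun N => s N * \prod_(1 <= l < N.+1) (1 + (lam m l ^+ 2)^-1)^-1) @ \oo --> (dg 0)^-1.
Proof.
apply: (@cvg_eventually _ _ _ 0%N _ (prod_limit (D_ge0 (lexx 0)) (ltrN10 R))) => N _.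
by congr (_ * _); apply: eq_big_nat => l /andP[l1 _]; rewrite add0r g_nat.
Qed.

End RealSide.

Local Open Scope complex_scope.

Theorem theorem3p8 (R : realType) (m : nat -> R)
  (mu : probability R R) (f : R[i]^o -> R[i]^o) (P : set R[i]^o) :
  (* the sequence (m_n) *)
  m 0%N = 1 ->
  (forall n, 0 < m n) ->
  (forall n, (1 <= n)%N -> (1 + \sum_(1 <= i < n.+1) m i) * m n = 1) ->
  (* mu : probability measure on [0,1] with moments m_n *)
  mu (~` `[0, 1]) = 0 ->
  (forall n, Rintegral mu `[0, 1] (fun t => t ^+ n) = m n) ->
  (* f meromorphic on C with pole set P *)
  (forall z, exists2 e : R, 0 < e &
     forall w, P w -> w != z -> e%:C <= `|w - z|) ->
  (forall z, ~ P z -> derivable f z 1) ->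
  (forall a, P a -> forall M : R, \forall z \near dnbhs a, M%:C < `|f z|) ->
  (* f extends z |-> int_0^1 (1 - t^z)/(1 - t) dmu(t) (Re z > 0); it is
     determined by its values on the positive real axis *)
  (forall x : R, 0 < x ->
     f x%:C = (Rintegral mu `[0, 1] (fun t => (1 - t `^ x) / (1 - t)))%:C) ->
  let Z (p : nat) : set R :=
    [set x | - (p%:R + 1) < x < - p%:R /\ ~ P x%:C /\ f x%:C = 0] in
  let xi (p k : nat) : R := xget 0 (kth (Z p) k) in
  (forall p k, (1 <= p)%N -> (1 <= k <= 2 ^ p.-1)%N ->
     (fun N : nat => Num.sqrt (2 * N%:R) *
        (\sum_(1 <= l < p.+1) (alpha R l (rr k l))^-1
         + \sum_(1 <= l < (N - p).+1) (lams (alpha R p k) l)^-1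
         - lam m N)) @ \oo --> xi p k
     /\
     exists2 L : R,
       (fun N : nat => Num.sqrt (2 * N%:R) *
          \prod_(1 <= l < N.+1) (1 + (lams (alpha R p k) l ^+ 2)^-1)^-1)
         @ \oo --> L &
       (derive1 f (xi p k)%:C)^-1 =
         ((\prod_(1 <= l < p.+1) (1 + (alpha R l (rr k l) ^+ 2)^-1)^-1) * L)%:C)
  /\
  exists2 L : R,
    (fun N : nat => Num.sqrt (2 * N%:R) *
       \prod_(1 <= l < N.+1) (1 + (lam m l ^+ 2)^-1)^-1) @ \oo --> L &
    (derive1 f 0)^-1 = L%:C.
Proof.
move=> m0 m_gt0 m_rec _ mom P_discrete f_der f_pole f_pos Z xi.
have fp : forall x : R, 0 < x -> f x%:C = (bernF mu x)%:C := f_pos.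
pose D (x : R) := ~ P x%:C.
have D_next := pole_shift m0 m_gt0 m_rec mom P_discrete f_der f_pole fp.
have g_neq0 := line_val_next_neq0 m0 m_gt0 m_rec mom P_discrete f_der f_pole fp.
have g_psi := line_val_psi m0 m_gt0 m_rec mom P_discrete f_der f_pole fp.
have fR := f_real m0 m_gt0 m_rec mom P_discrete f_der f_pole fp.
have g_der := line_val_derivative m0 m_gt0 m_rec mom P_discrete f_der f_pole fp.
have D_ge0 : forall x : R, 0 <= x -> D x := not_pole_ge0 m0 m_gt0 m_rec mom f_pole fp.
have D_prev (x : R) : D (x + 1) -> line_val f (x + 1) != 0 -> D x.
  move=> Dx gx; apply: (pole_shift_back m0 m_gt0 m_rec mom P_discrete f_der f_pole fp) => //.
  by rewrite (fR _ Dx) eq_complex /= eqxx andbT.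
have gpos : forall x : R, 0 < x -> line_val f x = bernF mu x by move=> x /fp e; rewrite /line_val e.
have g_nat (n : nat) : (0 < n)%N -> line_val f n%:R = lam m n.
  by move=> n0; rewrite gpos ?ltr0n//; exact: bernF_nat.
have g_ge0 (x : R) : 0 < x -> 0 <= line_val f x.
  by move=> x0; rewrite gpos//; exact: bernF_ge0.
have g_incr (x y h : R) : 0 < x -> x <= y -> 0 <= h ->
    0 <= line_val f (y + h) - line_val f y <= line_val f (x + h) - line_val f x.
  move=> x0 xy h0; have y0 := lt_le_trans x0 xy.
  rewrite (gpos _ x0) (gpos _ y0) (gpos _ (ltr_wpDr h0 x0)) (gpos _ (ltr_wpDr h0 y0)).
  exact: (bernF_increments m0 m_gt0 m_rec mom).
have dstep := line_der_step m0 m_gt0 m_rec mom P_discrete f_der f_pole fp.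
have hder (x : R) : D x -> has_derivative (line_val f) x (line_der f x) by move=> /g_der[].
have ZE p : Z p = zeros D (line_val f) p.
  rewrite /Z /zeros; apply/seteqP; split=> x [hx [Dx fx]]; split=> //; split=> //.
    by rewrite /line_val fx.
  by rewrite fR// fx.
split.
  move=> [//|p] [//|k] _ /andP[_ kp].
  have [Dx lim1 [L lim2 e]] := real_zeros m0 m_gt0 m_rec D_next g_neq0 g_psi D_prev hder
    dstep D_ge0 g_nat g_ge0 g_incr kp.
  rewrite /xi ZE; split; first exact: lim1.
  exists L; first exact: lim2.
  by have [-> _] := g_der _ Dx; rewrite -fmorphV e.
exists (line_der f 0)^-1.
  exact: (real_zero0 m0 m_gt0 m_rec D_next g_neq0 g_psi hder dstep D_ge0 g_nat g_ge0 g_incr).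
by have [e _] := g_der 0 (D_ge0 0 (lexx _)); rewrite [X in derive1 f X](_ : _ = 0%:C)// e fmorphV.
Qed.
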